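(* Let $G_1$ be a finite simple connected graph and $G_2$ a finite simple connected bipartite graph, with $h^*$-polynomials $H_1(t)$ and $H_2(t)$ of $\mathcal{P}_{G_1}$ and $\mathcal{P}_{G_2}$. Let $G$ be the graph obtained from the disjoint union of $G_1$ and $G_2$ by identifying an edge of $G_1$ with an edge of $G_2$. Then the $h^*$-polynomial of $\mathcal{P}_G$ equals $\frac{H_1(t)H_2(t)}{1+t}$. In particular, if $H_1$ and $H_2$ have only real roots, then so does the $h^*$-polynomial of $\mathcal{P}_G$.
   Context: For a graph $H=(V,E)$, $\mathcal{P}_H:=\mathrm{conv}\{\mathbf{e}_v-\mathbf{e}_w,\ \mathbf{e}_w-\mathbf{e}_v : \{v,w\}\in E\}\subset\mathbb{R}^V$; for connected $H$ it is a lattice polytope of dimension $d=|V|-1$. Its $h^*$-polynomial $h^*(t)$ is defined by $\sum_{j\ge0}|j\mathcal{P}_H\cap\mathbb{Z}^V|\,t^j=\frac{h^*(t)}{(1-t)^{d+1}}$. Identifying edges $\{v,w\}$ and $\{v',w'\}$ means identifying $v$ with $v'$, $w$ with $w'$ and the two edges. *)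

(* Defs.v *)
From HB Require Import structures.
From mathcomp Require Import all_boot all_order all_algebra finmap.
From mathcomp Require Import all_classical reals.
From mathcomp Require Import complex.

Set Implicit Arguments.
Unset Strict Implicit.
Unset Printing Implicit Defensive.

Import Order.TTheory GRing.Theory Num.Theory.
Local Open Scope classical_set_scope.
Local Open Scope ring_scope.

(** * Finite simple graphs *)

Record sgraph := SGraph {
  vertex :> finType;
  adj : rel vertex;
  adj_sym : symmetric adj;
  adj_irr : irreflexive adj }.

Definition sgraph_connected (G : sgraph) : Prop :=
  forall x y : G, connect (@adj G) x y.

Definition sgraph_bipartite (G : sgraph) : Prop :=
  exists c : G -> bool, forall x y : G, adj x y -> c x != c y.

(** * Identification of an edge *)

Definition sum_adj (G1 G2 : sgraph) (x y : G1 + G2) : bool :=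
  match x, y with
  | inl a, inl b => adj a b
  | inr a, inr b => adj a b
  | _, _ => false
  end.

(* The equivalence relation on the disjoint union generated by v1 ~ v2 and
   w1 ~ w2, when v1 != w1 and v2 != w2. *)
Definition edge_ident (G1 G2 : sgraph) (v1 w1 : G1) (v2 w2 : G2)
    (x y : G1 + G2) : bool :=
  match x, y with
  | inl a, inl b => a == b
  | inr a, inr b => a == b
  | inl a, inr b | inr b, inl a =>
      ((a == v1) && (b == v2)) || ((a == w1) && (b == w2))
  end.

(* G is the quotient of the disjoint union of G1 and G2, with projection pi. *)
Definition edge_gluing (G1 G2 G : sgraph) (v1 w1 : G1) (v2 w2 : G2)
    (pi : G1 + G2 -> G) : Prop :=
  [/\ forall a : G, exists x, pi x = a,
      forall x y, pi x = pi y <-> edge_ident v1 w1 v2 w2 x y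
    & forall a b : G,
        adj a b <-> exists x y, [/\ pi x = a, pi y = b & sum_adj x y]].

Lemma edge_gluing_exists (G1 G2 : sgraph) (v1 w1 : G1) (v2 w2 : G2) :
  adj v1 w1 -> adj v2 w2 ->
  exists (G : sgraph) (pi : G1 + G2 -> G), edge_gluing v1 w1 v2 w2 pi.
Proof.
move=> e1 e2.
have nvw1 : v1 != w1 by apply: contraTneq e1 => ->; rewrite adj_irr.
have nvw2 : v2 != w2 by apply: contraTneq e2 => ->; rewrite adj_irr.
pose Q : pred (G1 + G2) := fun x => (x != inr v2) && (x != inr w2).
pose rep (x : G1 + G2) : G1 + G2 :=
  if x == inr v2 then inl v1 else if x == inr w2 then inl w1 else x.
have repQ x : Q (rep x).
  rewrite /rep; case: (eqVneq x (inr v2)) => // n1.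
  by case: (eqVneq x (inr w2)) => // n2; rewrite /Q n1 n2.
pose V : finType := {x : G1 + G2 | Q x}.
pose pi x : V := exist _ (rep x) (repQ x).
have piE x y : pi x = pi y <-> edge_ident v1 w1 v2 w2 x y.
  transitivity (rep x = rep y).
    by split=> [/(congr1 val)//|h]; apply: val_inj.
  rewrite /rep /edge_ident.
  have inrE (a b : G2) : (@inr G1 G2 a == inr b) = (a == b) by [].
  case: x y => [a|a] [b|b] /=; rewrite ?inrE.
  - by split=> [[->]//|/eqP->].
  - case: (eqVneq b v2) => [->|nb].
      rewrite (negPf nvw2) andbF orbF andbT.
      by split=> [[->]//|/eqP->].
    case: (eqVneq b w2) => [_|nb']; rewrite ?andbF ?andbT //=.
    by split=> [[->]//|/eqP->].
  - case: (eqVneq a v2) => [->|na].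
      rewrite (negPf nvw2) andbF orbF andbT.
      by split=> [[->]//|/eqP->].
    case: (eqVneq a w2) => [_|na']; rewrite ?andbF ?andbT //=.
    by split=> [[->]//|/eqP->].
  - case: (eqVneq a b) => [->|nab]; first by split.
    split=> //.
    case: (eqVneq a v2) => [ea|_]; case: (eqVneq b v2) => [eb|_].
    + by rewrite ea eb eqxx in nab.
    + by case: (eqVneq b w2) => [_|_] // [h]; rewrite h eqxx in nvw1.
    + by case: (eqVneq a w2) => [_|_] // [h]; rewrite h eqxx in nvw1.
    + case: (eqVneq a w2) => [ea|_]; case: (eqVneq b w2) => [eb|_] //.
      * by rewrite ea eb eqxx in nab.
      * by case=> h; rewrite h eqxx in nab.
pose e : rel V := fun a b =>
  [exists x, [exists y, [&& pi x == a, pi y == b & sum_adj x y]]].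
have eP a b : e a b <-> exists x y, [/\ pi x = a, pi y = b & sum_adj x y].
  split=> [/existsP[x /existsP[y /and3P[/eqP ? /eqP ? ?]]]|]; first by exists x, y.
  by case=> x [y [<- <- h]]; apply/existsP; exists x; apply/existsP; exists y;
    rewrite !eqxx.
have sumC : symmetric (@sum_adj G1 G2).
  by case=> a [] b //=; rewrite adj_sym.
have e_sym : symmetric e.
  by move=> a b; apply/idP/idP => /(proj1 (eP _ _))[x [y [xa yb h]]];
    apply/(proj2 (eP _ _)); exists y, x; rewrite sumC.
have eirr : irreflexive e.
  move=> a; apply/negbTE/negP => /(proj1 (eP _ _))[x [y [<- /esym/(proj1 (piE _ _))]]].
  by case: x y => [x|x] [y|y] //= /eqP ->; rewrite adj_irr.
exists (SGraph e_sym eirr), pi; split => // a.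
exists (val a); apply: val_inj => /=; rewrite /rep.
by have /andP[/negPf -> /negPf ->] := valP a.
Qed.

(** * Symmetric edge polytopes *)

Definition conv_hull (R : realType) (V : finType) (S : set {ffun V -> R}) :
    set {ffun V -> R} :=
  [set x | exists (n : nat) (p : 'I_n -> {ffun V -> R}) (a : 'I_n -> R),
    [/\ forall i, S (p i), forall i, 0 <= a i, \sum_i a i = 1
      & x = [ffun v => \sum_i a i * p i v]]].

Definition unit_vec (R : realType) (V : finType) (v : V) : {ffun V -> R} :=
  [ffun u => (u == v)%:R].

(* As adj is symmetric, the generators include both e_v - e_w and e_w - e_v. *)
Definition sym_edge_polytope (R : realType) (G : sgraph) : set {ffun G -> R} :=
  conv_hull [set x | exists v w : G, adj v w /\ x = unit_vec R v - unit_vec R w].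
Arguments sym_edge_polytope : clear implicits.

(** * Ehrhart series and h*-polynomials *)

Definition int_lattice (R : realType) (V : finType) : set {ffun V -> R} :=
  [set x | forall v, x v \is a Num.int].
Arguments int_lattice : clear implicits.

Definition dilate_points (R : realType) (V : finType) (P : set {ffun V -> R})
    (j : nat) : set {ffun V -> R} :=
  [set [ffun v => j%:R * x v] | x in P] `&` int_lattice R V.

(* fset_set A is the finite set A only when A is finite;
   see finite_sym_edge_points. *)
Definition ehrhart (R : realType) (V : finType) (P : set {ffun V -> R})
    (j : nat) : nat :=
  #|` fset_set (dilate_points P j)|.

(* h(t) = (1 - t)^(d+1) * \sum_j ehrhart P j t^j as formal power series. *)
Definition is_hstar (R : realType) (V : finType) (P : set {ffun V -> R})
    (d : nat) (h : {poly R}) : Prop :=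
  forall n : nat,
    h`_n = \sum_(i < n.+1) ((1 - 'X) ^+ d.+1 : {poly R})`_i
                           * (ehrhart P (n - i))%:R.

(* For G connected the dimension of sym_edge_polytope R G is #|G| - 1. *)
Definition is_sep_hstar (R : realType) (G : sgraph) (h : {poly R}) : Prop :=
  is_hstar (sym_edge_polytope R G) #|G|.-1 h.

Definition real_rooted (R : realType) (p : {poly R}) : Prop :=
  forall z : R[i], root (map_poly (real_complex R) p) z -> complex.Im z = 0.

Lemma finite_sym_edge_points (R : realType) (G : sgraph) (j : nat) :
  finite_set (dilate_points (sym_edge_polytope R G) j).
Proof.
pose f (k : {ffun G -> 'I_(j + j).+1}) : {ffun G -> R} :=
  [ffun v => (k v)%:R - j%:R].
apply: (@sub_finite_set _ _ (range f)); last first.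
  exact/finite_image/finite_finset.
move=> _ [[_ [n [p [a [pS a0 a1 ->]]]] <-] xint].
have pb i v : `|p i v| <= 1.
  have [s [t [_ ->]]] := pS i; rewrite !ffunE.
  by case: eqP; case: eqP; rewrite ?subrr ?subr0 ?sub0r ?normrN ?normr1 ?normr0.
move: xint; set x := finfun _ => xint.
have xb v : `|x v| <= j%:R.
  rewrite !ffunE normrM ger0_norm // ler_piMr // -a1.
  apply: le_trans (ler_norm_sum _ _ _) _; apply: ler_sum => i _.
  by rewrite normrM ger0_norm // ler_piMr.
exists [ffun v => inord `|Num.floor (x v + j%:R)|%N] => //.
apply/ffunP => v; rewrite [LHS]ffunE [in LHS]ffunE.
have /intrP[m xm] := xint v.
have := xb v; rewrite xm ler_norml => /andP[lo hi].
have -> : m%:~R + j%:R = (m + j%:Z)%:~R :> R by rewrite intrD.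
rewrite intrKfloor.
have m0 : 0 <= m + j%:Z.
  by rewrite -(ler_int R) intrD /= -lerBlDr sub0r.
have mj : m + j%:Z <= (j + j)%N.
  by rewrite PoszD lerD2r -(ler_int R).
rewrite inordK; last by rewrite ltnS -lez_nat gez0_abs.
rewrite [X in X - _](_ : _ = (m + j%:Z)%:~R); last by rewrite -[in RHS](gez0_abs m0).
by rewrite intrD addrK.
Qed.

(* Main.v *)
Require Import Defs.
From HB Require Import structures.
From mathcomp Require Import all_boot all_order all_algebra finmap.
From mathcomp Require Import all_classical reals.
From mathcomp Require Import complex.
From mathcomp Require Import zify ring.
Import Order.TTheory GRing.Theory Num.Theory.
Local Open Scope classical_set_scope.
Local Open Scope ring_scope.

Set Implicit Arguments.
Unset Strict Implicit.
Unset Printing Implicit Defensive.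

(* For an integer vector x in the lattice spanned by the edge vectors
   e_v - e_w, let N(x) be the least number of edge vectors with sum x. Rounding
   real flows (total unimodularity) shows that j P_G contains x iff N(x) <= j,
   so that h*_G(t) = (1 - t)^d A_G(t) with A_G(t) = \sum_x t^N(x). It also shows
   that N(2 x) = 2 N(x), so that N is convex along lines.

   Let b be the edge vector of the glued edge. If G_2 is bipartite, N_2(x + b)
   and N_2(x) have different parities, and k |-> N_2(x + k b) is convex and
   1-Lipschitz; hence each coset x + Z b has a unique minimiser y, and
   N_2(y + k b) = N_2(y) + |k|. Writing B for the generating function of these
   "reduced" y, this gives A_2 = B (1 + t) / (1 - t). Every lattice vector of G is
   uniquely x_1 + y with y reduced, and then N(x_1 + y) = N_1(x_1) + N_2(y), so
   A_G = A_1 B and (1 + t) h*_G = H_1 H_2 as power series.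

   For divisibility in the polynomial ring it remains to see that
   (1 - t)^m A_G is a polynomial for some m. Each x has a flow that is minimal
   for the size and then lexicographically, together with all its multiples;
   whether a flow is of this kind depends only on its support, so A_G is a sum
   of terms (t / (1 - t))^|S|. *)

(** * Congruences modulo a power of X *)

Notation "p = q %[modX N ]" := (take_poly N p = take_poly N q)
  (at level 70, q at next level, format "p  =  q  %[modX  N ]") : ring_scope.

Section CongruenceModX.
Variable R : comNzRingType.
Implicit Types p q c : {poly R}.

Lemma eqmodXP N p q :
  p = q %[modX N] <-> forall i, (i < N)%N -> p`_i = q`_i.
Proof.
split=> [/polyP pq i iN|pq]; first by have := pq i; rewrite !coef_take_poly iN.
by apply/polyP => i; rewrite !coef_take_poly; case: ifP => // /pq.
Qed.

Lemma eqmodX_eq p q : (forall N, p = q %[modX N]) -> p = q.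
Proof. by move=> pq; apply/polyP => i; apply: (eqmodXP _ _ _).1 (pq i.+1) _ _. Qed.

Lemma eqmodXM N p q p' q' :
  p = q %[modX N] -> p' = q' %[modX N] -> p * p' = q * q' %[modX N].
Proof.
move=> /eqmodXP pq /eqmodXP pq'; apply/eqmodXP => n nN; rewrite !coefM.
apply: eq_bigr => i _; rewrite pq ?pq' //.
  exact: leq_ltn_trans (leq_subr _ _) nN.
by apply: leq_ltn_trans nN; rewrite -ltnS.
Qed.

Lemma eqmodXMl N c p q : p = q %[modX N] -> c * p = c * q %[modX N].
Proof. exact: eqmodXM. Qed.

Lemma eqmodX_sum (I : Type) (r : seq I) (P : pred I) N (F F' : I -> {poly R}) :
  (forall i, P i -> F i = F' i %[modX N]) ->
  \sum_(i <- r | P i) F i = \sum_(i <- r | P i) F' i %[modX N].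
Proof. by move=> FF'; rewrite !take_poly_sum; apply: eq_bigr. Qed.

Lemma eqmodX_prod (I : Type) (r : seq I) (P : pred I) N (F F' : I -> {poly R}) :
  (forall i, P i -> F i = F' i %[modX N]) ->
  \prod_(i <- r | P i) F i = \prod_(i <- r | P i) F' i %[modX N].
Proof.
move=> FF'; apply: (big_ind2 (fun p q => p = q %[modX N])) => // *.
exact: eqmodXM.
Qed.

Lemma eqmodX_subMXn N p q : p - q * 'X^N = p %[modX N].
Proof. by rewrite raddfB /= take_polyMXn_0 subr0. Qed.

Lemma eqmodX_mulI N c p q :
  c`_0 = 1 -> c * p = c * q %[modX N] -> p = q %[modX N].
Proof.
move=> c0 /eqmodXP cpq; apply/eqmodXP.
elim/ltn_ind=> n IHn nN; have := cpq n nN.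
rewrite !coefM !big_ord_recl /= c0 !mul1r !subn0.
rewrite (eq_bigr (fun i : 'I_n => c`_(bump 0 i) * q`_(n - bump 0 i))).
  exact: addIr.
by move=> i _; rewrite IHn //=; have := ltn_ord i; rewrite /bump /=; lia.
Qed.

Lemma geometric_sum m n : (m <= n)%N ->
  (1 - 'X) * \sum_(m <= j < n) 'X^j = 'X^m - 'X^n :> {poly R}.
Proof.
move=> mn; rewrite mulr_sumr -[RHS]opprB -(telescope_sumr (fun j => 'X^j)) // -sumrN.
by apply: eq_bigr => j _; rewrite opprB mulrBl mul1r -exprS.
Qed.

End CongruenceModX.

(** * Truncated generating functions *)

Section GeneratingFunction.
Variable R : idomainType.
Implicit Types T U : choiceType.

Definition sublevel T (A : set T) (w : T -> nat) (N : nat) : set T :=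
  A `&` [set x | (w x < N)%N].

Definition graded_finite T (A : set T) (w : T -> nat) : Prop :=
  forall N, finite_set (sublevel A w N).

Definition genfun T (A : set T) (w : T -> nat) (N : nat) : {poly R} :=
  \sum_(x \in sublevel A w N) ('X^(w x) : {poly R}).

Lemma genfun_bij T U (A : set T) (B : set U) wA wB (h : T -> U) N :
  set_bij A B h -> (forall x, A x -> wB (h x) = wA x) ->
  genfun B wB N = genfun A wA N.
Proof.
case=> hAB hinj hsurj hw; rewrite /genfun (reindex_fsbig h (sublevel A wA N)).
  by apply: eq_fsbigr => x; rewrite inE => -[Ax _]; rewrite hw.
split.
- by move=> x [Ax wx]; split; [apply: hAB|rewrite /= hw].
- by move=> x y; rewrite !inE => -[Ax _] [Ay _]; apply: hinj; rewrite inE.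
- move=> y [By wy]; have [x Ax xy] := hsurj _ By.
  by exists x => //; split=> //=; rewrite -hw // xy.
Qed.

Lemma genfun_widen T (A B : set T) w N : finite_set B -> B `<=` A ->
  sublevel A w N `<=` B ->
  \sum_(x \in B) ('X^(w x) : {poly R}) = genfun A w N %[modX N].
Proof.
move=> finB BA AB; rewrite (fsbigID [set x | (w x < N)%N]) //= /genfun.
have -> : B `&` [set x | (w x < N)%N] = sublevel A w N.
  by apply/seteqP; split=> x [xB xN]; split=> //; [apply: BA|apply: AB].
rewrite take_polyD -[RHS]addr0; congr (_ + _).
rewrite fsbig_finite; last exact: finite_setIl.
rewrite take_poly_sum big_seq big1 // => x.
rewrite in_fset_set; last exact: finite_setIl.
rewrite inE => -[_ /= /negP]; rewrite -leqNgt => Nw.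
by rewrite -(subnK Nw) exprD take_polyMXn_0.
Qed.

Lemma genfun_setX T U (A : set T) (B : set U) wA wB N :
  graded_finite A wA -> graded_finite B wB ->
  genfun A wA N * genfun B wB N
    = genfun (A `*` B) (fun p => wA p.1 + wB p.2)%N N %[modX N].
Proof.
move=> finA finB; rewrite /genfun mulr_fsuml.
under eq_fsbigr => x _ do rewrite mulr_fsumr.
rewrite (pair_fsbig _ (fun x y => 'X^(wA x) * 'X^(wB y))) //.
under eq_fsbigr do rewrite -exprD.
apply: (@genfun_widen (T * U)%type) => /=.
- exact: finite_setX.
- by move=> [x y] [[Ax _] [By _]].
- move=> [x y] [[/= Ax By] wN]; split; split=> //=.
    exact: leq_ltn_trans (leq_addr _ _) wN.
  exact: leq_ltn_trans (leq_addl _ _) wN.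
Qed.

Lemma sublevel_absz N :
  sublevel [set: int] absz N `<=` Posz @` `I_N `|` Negz @` `I_N.
Proof. by move=> [n|n] [_ /= nN]; [left|right]; exists n => //=; lia. Qed.

Lemma finite_signed_itv N : finite_set (Posz @` `I_N `|` Negz @` `I_N).
Proof. by rewrite finite_setU; split; apply/finite_image/finite_II. Qed.

Lemma graded_finite_absz : graded_finite [set: int] absz.
Proof.
by move=> N; apply: sub_finite_set (@sublevel_absz N) (finite_signed_itv N).
Qed.

Lemma genfun_absz N :
  (1 - 'X) * genfun [set: int] absz N = 1 + 'X %[modX N].
Proof.
have sumE : \sum_(k \in Posz @` `I_N `|` Negz @` `I_N) ('X^`|k|%N : {poly R})
            = (1 + 'X) * \sum_(0 <= i < N) 'X^i.
  rewrite fsbigU0; [|exact/finite_image/finite_II..|by move=> _ [[i _ <-] []]].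
  rewrite !fsbig_image; [|by move=> ? ? _ _ []..].
  rewrite -!fsbig_ord !big_mkord mulrDl mul1r mulr_sumr; congr (_ + _).
  by apply: eq_bigr => i _; rewrite -exprS.
have := genfun_widen (finite_signed_itv N) (@subsetT _ _) (@sublevel_absz N).
move=> /(eqmodXMl (1 - 'X)) <-.
rewrite sumE mulrCA geometric_sum // expr0 mulrBr mulr1.
exact: eqmodX_subMXn.
Qed.

Lemma genfun_cumulative T (A : set T) w N : graded_finite A w ->
  (1 - 'X) * \poly_(j < N) (#|` fset_set (sublevel A w j.+1)|%:R : R)
    = genfun A w N %[modX N].
Proof.
move=> finA; set F := fset_set (sublevel A w N).
have FP x : x \in F -> (w x < N)%N by rewrite in_fset_set ?inE // => -[].
have cardE j : (j < N)%N ->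
    #|` fset_set (sublevel A w j.+1)|%:R = \sum_(x <- F) (w x <= j)%:R :> R.
  move=> jN; rewrite card_fset_sum1 natr_sum -fsbig_finite; last exact: finA.
  have -> : sublevel A w j.+1 = sublevel A w N `&` [set x | (w x <= j)%N].
    apply/seteqP; split=> x [] //; last by move=> [].
    by move=> Ax wx; split=> //; split=> //=; apply: leq_trans wx jN.
  rewrite fsbig_mkcondr fsbig_finite //; apply: eq_bigr => x _.
  by case: ifPn; [rewrite inE /= => ->|rewrite notin_setE /= => /negP/negPf ->].
have -> : \poly_(j < N) (#|` fset_set (sublevel A w j.+1)|%:R : R) =
          \sum_(x <- F) \sum_(w x <= j < N) 'X^j.
  rewrite poly_def [RHS]big_seq.
  under [RHS]eq_bigr => x /FP/ltnW wN do
    rewrite (big_nat_widenl _ 0) // big_mkcond /= big_mkord.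
  rewrite -big_seq [RHS]exchange_big; apply: eq_bigr => j _.
  rewrite cardE // scaler_suml; apply: eq_bigr => x _.
  by case: ifP; rewrite ?scale1r ?scale0r.
rewrite mulr_sumr /genfun fsbig_finite // -/F !big_seq; apply: eqmodX_sum => x xF.
by rewrite geometric_sum 1?ltnW ?FP // -['X^N]mul1r eqmodX_subMXn.
Qed.

End GeneratingFunction.

(** * Word norms in abelian groups *)

Section WordNorm.
Variables (L : nmodType) (S : {pred L}).
Implicit Types (x y b : L) (s : seq L).

Definition word_span : set L :=
  [set x | exists2 s, all [in S] s & \sum_(b <- s) b = x].

Definition is_word_length x : pred nat :=
  fun n => `[< exists s, [/\ all [in S] s, \sum_(b <- s) b = x & size s = n] >].

(* Junk value [0] outside [word_span]. *)
Definition word_norm x : nat :=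
  if pselect (exists n, is_word_length x n) is left ex then ex_minn ex else 0%N.

Lemma word_normP x : word_span x ->
  exists s, [/\ all [in S] s, \sum_(b <- s) b = x & size s = word_norm x].
Proof.
case=> s Ss sx; rewrite /word_norm; case: pselect => [ex|[]]; last first.
  by exists (size s); apply/asboolP; exists s.
by case: ex_minnP => n /asboolP.
Qed.

Lemma word_norm_le s : all [in S] s -> (word_norm (\sum_(b <- s) b) <= size s)%N.
Proof.
move=> Ss; rewrite /word_norm; case: pselect => [ex|[]]; last first.
  by exists (size s); apply/asboolP; exists s.
by case: ex_minnP => n _; apply; apply/asboolP; exists s.
Qed.

Lemma word_span_sum s : all [in S] s -> word_span (\sum_(b <- s) b).
Proof. by exists s. Qed.

Lemma word_span0 : word_span 0.
Proof. by exists [::]; rewrite ?big_nil. Qed.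

Lemma word_norm0 : word_norm 0 = 0%N.
Proof. by apply/eqP; have := @word_norm_le [::] isT; rewrite big_nil leqn0. Qed.

Lemma word_spanD x y : word_span x -> word_span y -> word_span (x + y).
Proof.
by move=> [s Ss <-] [t St <-]; exists (s ++ t); rewrite ?big_cat // all_cat Ss.
Qed.

Lemma word_normD x y : word_span x -> word_span y ->
  (word_norm (x + y) <= word_norm x + word_norm y)%N.
Proof.
move=> /word_normP[s [Ss <- <-]] /word_normP[t [St <- <-]].
by rewrite -big_cat -size_cat word_norm_le // all_cat Ss.
Qed.

Lemma word_span_gen b : b \in S -> word_span b.
Proof. by move=> Sb; exists [:: b]; rewrite ?big_seq1 //= Sb. Qed.

Lemma word_spanMn x n : word_span x -> word_span (x *+ n).
Proof.
move=> x_span; elim: n => [|n IHn]; first exact: word_span0.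
by rewrite mulrS; apply: word_spanD.
Qed.

Lemma word_norm_genMn b n : b \in S -> (word_norm (b *+ n) <= n)%N.
Proof.
move=> Sb; have <- : \sum_(c <- nseq n b) c = b *+ n.
  by rewrite big_nseq iter_addr_0.
by rewrite -[leqRHS](size_nseq n b) word_norm_le // all_nseq Sb orbT.
Qed.

Lemma word_norm_gen b : b \in S -> (word_norm b <= 1)%N.
Proof. exact: (@word_norm_genMn b 1). Qed.

Lemma word_normD_gen x b :
  word_span x -> b \in S -> (word_norm (x + b) <= (word_norm x).+1)%N.
Proof.
move=> x_span Sb; rewrite -addn1.
apply: leq_trans (word_normD x_span (word_span_gen Sb)) _.
by rewrite leq_add2l word_norm_gen.
Qed.

End WordNorm.

Section MapWordNorm.
Variables (L M : nmodType) (S : {pred L}) (T : {pred M}) (h : {additive L -> M}).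
Hypothesis hST : {in S, forall b, h b \in T}.

Let all_map_gen s : all [in S] s -> all [in T] (map h s).
Proof. by rewrite all_map; apply: sub_all => b /hST. Qed.

Lemma word_span_map x : word_span S x -> word_span T (h x).
Proof.
move=> [s Ss <-]; rewrite raddf_sum -(big_map h predT id).
exact/word_span_sum/all_map_gen.
Qed.

Lemma word_norm_map x : word_span S x -> (word_norm T (h x) <= word_norm S x)%N.
Proof.
move=> /word_normP[s [Ss <- <-]].
rewrite raddf_sum -(big_map h predT id) -(size_map h).
exact/word_norm_le/all_map_gen.
Qed.

End MapWordNorm.

Section SymmetricWordNorm.
Variables (L : zmodType) (S : {pred L}).
Hypothesis symS : {in S, forall b, - b \in S}.
Implicit Types (x y b : L) (k : int).

Lemma word_spanN x : word_span S x -> word_span S (- x).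
Proof. exact: (word_span_map (h := -%R)). Qed.

Lemma word_spanB x y : word_span S x -> word_span S y -> word_span S (x - y).
Proof. by move=> x_span y_span; apply: word_spanD => //; apply: word_spanN. Qed.

Lemma word_spanMz x k : word_span S x -> word_span S (x *~ k).
Proof.
by case: k => n x_span; [apply: word_spanMn|apply/word_spanN/word_spanMn].
Qed.

Lemma word_normN x : word_span S x -> word_norm S (- x) = word_norm S x.
Proof.
have leN y : word_span S y -> (word_norm S (- y) <= word_norm S y)%N.
  exact: (word_norm_map (h := -%R)).
move=> x_span; apply/eqP; rewrite eqn_leq leN //=.
by rewrite -[x in leqLHS]opprK leN //; apply: word_spanN.
Qed.

Lemma word_norm_genMz b k : b \in S -> (word_norm S (b *~ k) <= `|k|)%N.
Proof.
move=> Sb; case: k => n; first exact: word_norm_genMn.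
rewrite NegzE mulrNz word_normN; first exact: word_norm_genMn.
exact/word_spanMn/word_span_gen.
Qed.

End SymmetricWordNorm.

Section OddGenerators.
Variables (L : zmodType) (S : {pred L}) (chi : {additive L -> int}).
Hypothesis symS : {in S, forall b, - b \in S}.
Hypothesis odd_chi : {in S, forall b, odd `|chi b|}.

Lemma odd_word_norm x : word_span S x -> odd (word_norm S x) = odd `|chi x|.
Proof.
move=> /word_normP[s [Ss <- <-]]; elim: s Ss => [|b s IHs] /=.
  by rewrite big_nil raddf0.
case/andP=> /odd_chi chi_b /IHs; rewrite big_cons raddfD /=; lia.
Qed.

Lemma word_normD_gen_or x b : word_span S x -> b \in S ->
  word_norm S (x + b) = (word_norm S x).+1
  \/ word_norm S x = (word_norm S (x + b)).+1.
Proof.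
move=> x_span Sb; have b_span := word_span_gen Sb.
have xb_span := word_spanD x_span b_span.
have := odd_word_norm xb_span; rewrite raddfD /=.
have := odd_word_norm x_span; have := odd_chi Sb.
have := word_normD_gen xb_span (symS Sb); rewrite addrK.
have := word_normD_gen x_span Sb.
lia.
Qed.

End OddGenerators.

Definition reduced (L : zmodType) (S : {pred L}) (b : L) : set L :=
  [set y | [/\ word_span S y, word_norm S (y + b) = (word_norm S y).+1
             & word_norm S (y - b) = (word_norm S y).+1]].

Section Reduced.
Variables (L : zmodType) (S : {pred L}) (b : L).
Hypothesis symS : {in S, forall c, - c \in S}.
Hypothesis word_norm_double :
  forall x, word_span S x -> ((word_norm S x).*2 <= word_norm S (x + x))%N.
Hypothesis Sb : b \in S.
Implicit Types (x y : L) (k : int).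

Let spanMz k : word_span S (b *~ k).
Proof. exact/word_spanMz/word_span_gen. Qed.

(* [word_norm_double] makes [n |-> word_norm S (y + c *+ n)] convex, so that
   its slope, once equal to 1, never decreases. *)
Lemma word_norm_ray y c n : word_span S y -> c \in S ->
  word_norm S (y + c) = (word_norm S y).+1 ->
  word_norm S (y + c *+ n) = (word_norm S y + n)%N.
Proof.
move=> y_span Sc yc.
have c_span := word_span_gen Sc.
have ray_span m : word_span S (y + c *+ m) by apply/word_spanD/word_spanMn.
suff: word_norm S (y + c *+ n) = (word_norm S y + n)%N /\
      word_norm S (y + c *+ n.+1) = (word_norm S y + n.+1)%N by case.
elim: n => [|n [IHn IHn1]]; first by rewrite mulr0n addr0 addn0 mulr1n yc addn1.
split=> //.
have convex : ((word_norm S (y + c *+ n.+1)).*2 <=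
               word_norm S (y + c *+ n.+2) + word_norm S (y + c *+ n))%N.
  apply: leq_trans (word_norm_double (ray_span _)) _.
  have -> : (y + c *+ n.+1) + (y + c *+ n.+1) = (y + c *+ n.+2) + (y + c *+ n).
    by rewrite addrACA [RHS]addrACA -!mulrnDr; congr (_ + _ *+ _); lia.
  exact: word_normD.
have lipschitz := word_normD_gen (ray_span n.+1) Sc.
rewrite -addrA -mulrSr IHn1 in lipschitz; rewrite IHn IHn1 in convex.
set m := word_norm S (y + c *+ n.+2) in convex lipschitz *; lia.
Qed.

Lemma word_norm_reduced y k : reduced S b y ->
  word_norm S (y + b *~ k) = (word_norm S y + `|k|)%N.
Proof.
case=> y_span yp ym; case: k => n; first exact: word_norm_ray.
by rewrite NegzE mulrNz -mulNrz abszN; apply: word_norm_ray => //; apply: symS.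
Qed.

Lemma reduced_uniq y k : reduced S b y -> reduced S b (y + b *~ k) -> k = 0.
Proof.
move=> /(word_norm_reduced k) yk /(word_norm_reduced (- k)).
by rewrite mulrNz addrK; lia.
Qed.

Variable chi : {additive L -> int}.
Hypothesis odd_chi : {in S, forall c, odd `|chi c|}.

Lemma reduced_exists x : word_span S x -> exists k, reduced S b (x + b *~ k).
Proof.
move=> x_span; have line_span k := word_spanD x_span (spanMz k).
have ex_norm : exists n, `[< exists k, word_norm S (x + b *~ k) = n >].
  by exists (word_norm S (x + b *~ 0)); apply/asboolP; exists 0.
case: (ex_minnP ex_norm) => n /asboolP[k kn] nmin.
have kmin j : (word_norm S (x + b *~ k) <= word_norm S (x + b *~ j))%N.
  by rewrite kn; apply: nmin; apply/asboolP; exists j.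
exists k; split=> //.
- have := kmin (k + 1); rewrite mulrzDr mulr1z addrA.
  by have [//|->] := word_normD_gen_or symS odd_chi (line_span k) Sb; rewrite ltnn.
- have := kmin (k - 1); rewrite mulrzBr mulr1z addrA.
  have [//|->] := word_normD_gen_or symS odd_chi (line_span k) (symS Sb).
  by rewrite ltnn.
Qed.

Lemma reduced_bij :
  set_bij (reduced S b `*` [set: int]) (word_span S) (fun p => p.1 + b *~ p.2).
Proof.
split.
- by move=> [y k] [/= [y_span _ _] _]; apply: word_spanD.
- move=> [y k] [y' k']; rewrite !inE => -[/= yred _] [/= yred' _] yky'k'.
  have y'E : y' = y + b *~ (k - k') by rewrite mulrzBr addrA yky'k' addrK.
  have kk' : k = k' by apply/subr0_eq/(reduced_uniq yred); rewrite -y'E.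
  by rewrite y'E kk' subrr mulr0z addr0.
- move=> x /reduced_exists[k xred]; exists (x + b *~ k, - k) => //=.
  by rewrite mulrNz addrK.
Qed.

Hypothesis span_graded : graded_finite (word_span S) (word_norm S).

Lemma graded_finite_reduced : graded_finite (reduced S b) (word_norm S).
Proof. by move=> N; apply: sub_finite_set (span_graded N) => y [[]]. Qed.

Lemma genfun_reduced (R : idomainType) N :
  (1 - 'X) * genfun R (word_span S) (word_norm S) N
    = (1 + 'X) * genfun R (reduced S b) (word_norm S) N %[modX N].
Proof.
pose w (p : L * int) := (word_norm S p.1 + `|p.2|)%N.
have -> := @genfun_bij R _ _ _ _ w (word_norm S) _ N reduced_bij; last first.
  by move=> [y k] [/= yred _]; apply: word_norm_reduced.
have prod := genfun_setX R N graded_finite_reduced graded_finite_absz.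
rewrite -(eqmodXMl _ prod) mulrCA mulrC.
by apply: eqmodXM => //; apply: genfun_absz.
Qed.

End Reduced.

(* [L] is the amalgam of [L1] and [L2] along [b1] and [b2], and [S] is the union
   of the images of [S1] and [S2]. *)
Section Amalgam.
Variables (L1 L2 L : zmodType) (S1 : {pred L1}) (S2 : {pred L2}) (S : {pred L}).
Variables (i1 : {additive L1 -> L}) (i2 : {additive L2 -> L}) (b1 : L1) (b2 : L2).
Hypothesis i1S : {in S1, forall x, i1 x \in S}.
Hypothesis i2S : {in S2, forall y, i2 y \in S}.
Hypothesis genS : {in S, forall z,
  (exists2 x, x \in S1 & z = i1 x) \/ (exists2 y, y \in S2 & z = i2 y)}.
Hypothesis i1b_i2b : i1 b1 = i2 b2.
Hypothesis amalgam_kernel : forall x y,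
  word_span S1 x -> word_span S2 y -> i1 x + i2 y = 0 ->
  exists k : int, x = - (b1 *~ k) /\ y = b2 *~ k.

Hypothesis symS1 : {in S1, forall x, - x \in S1}.
Hypothesis symS2 : {in S2, forall y, - y \in S2}.
Hypothesis S1b1 : b1 \in S1.
Hypothesis S2b2 : b2 \in S2.
Hypothesis word_norm_double2 :
  forall y, word_span S2 y -> ((word_norm S2 y).*2 <= word_norm S2 (y + y))%N.
Variable chi : {additive L2 -> int}.
Hypothesis odd_chi : {in S2, forall y, odd `|chi y|}.

Let amalgam (p : L1 * L2) : L := i1 p.1 + i2 p.2.

Lemma amalgam_span x y :
  word_span S1 x -> word_span S2 y -> word_span S (i1 x + i2 y).
Proof.
move=> /(word_span_map i1S) x_span /(word_span_map i2S) y_span.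
exact: word_spanD.
Qed.

Lemma amalgam_norm_le x y : word_span S1 x -> word_span S2 y ->
  (word_norm S (i1 x + i2 y) <= word_norm S1 x + word_norm S2 y)%N.
Proof.
move=> x_span y_span.
have [x'_span y'_span] := (word_span_map i1S x_span, word_span_map i2S y_span).
apply: leq_trans (word_normD x'_span y'_span) _.
by rewrite leq_add // word_norm_map.
Qed.

Lemma amalgam_split z : word_span S z ->
  exists x y, [/\ word_span S1 x, word_span S2 y, i1 x + i2 y = z
                & (word_norm S1 x + word_norm S2 y <= word_norm S z)%N].
Proof.
move=> /word_normP[s [Ss <- <-]]; elim: s Ss => [|c s IHs] /=.
  exists 0, 0; split; rewrite ?raddf0 ?addr0 ?big_nil ?word_norm0 //;
    exact: word_span0.
case/andP=> /genS Sc /IHs[x [y [x_span y_span xy_sum xy_norm]]].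
case: Sc => -[a Sa ->]; have a_span := word_span_gen Sa.
- exists (x + a), y; split=> //; first exact: word_spanD.
    by rewrite raddfD addrAC xy_sum addrC big_cons.
  by apply: leq_trans (leq_add (word_normD_gen x_span Sa) (leqnn _)) _.
- exists x, (y + a); split=> //; first exact: word_spanD.
    by rewrite raddfD addrA xy_sum addrC big_cons.
  apply: leq_trans (leq_add (leqnn _) (word_normD_gen y_span Sa)) _.
  by rewrite addnS.
Qed.

Lemma amalgam_eq_shift x y x' y' :
  word_span S1 x -> word_span S2 y -> word_span S1 x' -> word_span S2 y' ->
  i1 x + i2 y = i1 x' + i2 y' ->
  exists k : int, x' = x - b1 *~ k /\ y' = y + b2 *~ k.
Proof.
move=> x_span y_span x'_span y'_span xyE.
have [|||k [xk yk]] := @amalgam_kernel (x' - x) (y' - y).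
- exact: word_spanB.
- exact: word_spanB.
- by rewrite !raddfB /= addrACA -opprD -xyE subrr.
by exists k; rewrite -xk -yk ![_ + (_ - _)]addrC !subrK.
Qed.

Lemma amalgam_reduced_norm x y : word_span S1 x -> reduced S2 b2 y ->
  word_norm S (i1 x + i2 y) = (word_norm S1 x + word_norm S2 y)%N.
Proof.
move=> x_span yred; have [y_span _ _] := yred.
apply/eqP; rewrite eqn_leq amalgam_norm_le //=.
have [x' [y' [x'_span y'_span xyE normS]]] :=
  amalgam_split (amalgam_span x_span y_span).
apply: leq_trans normS.
have [k [x'E y'E]] := amalgam_eq_shift x_span y_span x'_span y'_span (esym xyE).
have y'_norm := word_norm_reduced symS2 word_norm_double2 S2b2 k yred.
have x_norm : (word_norm S1 x <= word_norm S1 x' + `|k|)%N.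
  have -> : x = x' + b1 *~ k by rewrite x'E subrK.
  have b1k_span := word_spanMz symS1 k (word_span_gen S1b1).
  apply: leq_trans (word_normD x'_span b1k_span) _.
  by rewrite leq_add2l word_norm_genMz.
by rewrite y'E y'_norm addnCA [leqRHS]addnC leq_add2r.
Qed.

Lemma amalgam_bij :
  set_bij (word_span S1 `*` reduced S2 b2) (word_span S) amalgam.
Proof.
split.
- by move=> [x y] [/= x_span [y_span _ _]]; apply: amalgam_span.
- move=> [x y] [x' y']; rewrite !inE => -[/= x_span yred] [/= x'_span y'red].
  have [[y_span _ _] [y'_span _ _]] := (yred, y'red).
  move=> /(amalgam_eq_shift x_span y_span x'_span y'_span)[k [-> y'E]].
  move: y'red; rewrite y'E => /(reduced_uniq symS2 word_norm_double2 S2b2 yred) ->.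
  by rewrite !mulr0z subr0 addr0.
- move=> z /amalgam_split[x [y [x_span y_span <- _]]].
  have [k yred] := reduced_exists symS2 S2b2 odd_chi y_span.
  exists (x - b1 *~ k, y + b2 *~ k); first split=> //=.
    by apply: word_spanB => //; apply/word_spanMz/word_span_gen.
  rewrite /amalgam raddfB raddfD /= (raddfMz i1) (raddfMz i2) i1b_i2b.
  by rewrite addrACA addNr addr0.
Qed.

Lemma genfun_amalgam (R : idomainType) N :
  graded_finite (word_span S1) (word_norm S1) ->
  graded_finite (word_span S2) (word_norm S2) ->
  genfun R (word_span S) (word_norm S) N =
  genfun R (word_span S1) (word_norm S1) N
    * genfun R (reduced S2 b2) (word_norm S2) N %[modX N].
Proof.
move=> graded1 /(graded_finite_reduced b2) graded2.
pose w (p : L1 * L2) := (word_norm S1 p.1 + word_norm S2 p.2)%N.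
have -> := @genfun_bij R _ _ _ _ w (word_norm S) _ N amalgam_bij; last first.
  by move=> [x y] [/= x_span yred]; apply: amalgam_reduced_norm.
exact/esym/genfun_setX.
Qed.

End Amalgam.

(** * Rounding of flows *)

Definition vertex_sum (V : finType) (P : pred V) (x : {ffun V -> int}) : int :=
  \sum_(v | P v) x v.

Fact vertex_sum_is_zmod_morphism (V : finType) (P : pred V) :
  zmod_morphism (vertex_sum P).
Proof.
by move=> x y; rewrite /vertex_sum -sumrB; apply: eq_bigr => v _; rewrite !ffunE.
Qed.
HB.instance Definition _ (V : finType) (P : pred V) :=
  GRing.isZmodMorphism.Build {ffun V -> int} int (vertex_sum P)
    (vertex_sum_is_zmod_morphism P).

Definition arc_vec (V : finType) (e : V * V) : {ffun V -> int} :=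
  [ffun v => (v == e.1)%:R - (v == e.2)%:R].

Lemma vertex_sum_arc_vec (V : finType) (P : pred V) (e : V * V) :
  vertex_sum P (arc_vec e) = (P e.1)%:R - (P e.2)%:R.
Proof.
have sum_delta a : \sum_(v | P v) (v == a)%:R = (P a)%:R :> int.
  rewrite big_mkcond (bigD1 a) //= eqxx big1 ?addr0; first by case: (P a).
  by move=> v /negPf ->; case: ifP.
by rewrite /vertex_sum; under eq_bigr do rewrite ffunE; rewrite sumrB !sum_delta.
Qed.

Section Divergence.
Variables (R : pzRingType) (V : finType).
Implicit Types f g : V * V -> R.

Definition divergence f (v : V) : R := \sum_e f e * (arc_vec e v)%:~R.

Lemma divergenceD f g v :
  divergence (fun e => f e + g e) v = divergence f v + divergence g v.
Proof. by rewrite -big_split; apply: eq_bigr => e _; rewrite mulrDl. Qed.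

Lemma divergenceZ a f v : divergence (fun e => a * f e) v = a * divergence f v.
Proof. by rewrite /divergence mulr_sumr; apply: eq_bigr => e _; rewrite mulrA. Qed.

End Divergence.

Lemma rowV_kernel_exists (F : fieldType) m n (M : 'M[F]_(m, n)) (c : 'cV[F]_n) :
  (n <= m)%N -> c != 0 -> M *m c = 0 -> exists2 r : 'rV_m, r != 0 & r *m M = 0.
Proof.
move=> nm c0 Mc; have rkM : (\rank M < m)%N.
  apply: leq_trans nm; rewrite ltn_neqAle rank_leq_col andbT.
  apply: contra_neqN c0 => /row_fullP[B BM].
  by rewrite -[c]mul1mx -BM -mulmxA Mc mulmx0.
have : kermx M != 0 by rewrite kermx_eq0 /row_free neq_ltn rkM.
by case/rowV0Pn => r /sub_kermxP rM r0; exists r.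
Qed.

Section Circulation.
Variables (V : finType) (S : {set V * V}).

Definition touched : {set V} :=
  [set v | [exists e in S, arc_vec e v != 0]]%SET.

Lemma mem_touched e v : e \in S -> arc_vec e v != 0 -> v \in touched.
Proof. by move=> eS ev; rewrite inE; apply/exists_inP; exists e. Qed.

Hypothesis no_leaf : forall e v, e \in S -> arc_vec e v != 0 ->
  exists2 e', e' \in S & (e' != e) && (arc_vec e' v != 0).

Lemma card_touched_le : (#|touched| <= #|S|)%N.
Proof.
rewrite -(leq_pmul2r (isT : (0 < 2)%N)) -!sum_nat_const.
apply: (@leq_trans (\sum_(v in touched) \sum_(e in S) (arc_vec e v != 0))%N).
  apply: leq_sum => v; rewrite inE => /exists_inP[e eS ev].
  have [e' e'S /andP[e'e e'v]] := no_leaf eS ev.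
  by rewrite (bigD1 e) //= (bigD1 e') /= ?e'S // ev e'v.
rewrite exchange_big; apply: leq_sum => e _.
apply: leq_trans (_ : #|[set e.1; e.2]%SET| <= 2)%N; last first.
  by rewrite cards2; case: eqP.
rewrite -sum1_card [X in (X <= _)%N]big_mkcond [X in (_ <= X)%N]big_mkcond.
apply: leq_sum => v _; rewrite !inE ffunE.
by case: (v == e.1); case: (v == e.2) => //; case: ifP.
Qed.

Lemma touched_endpoints e : e \in S -> e.1 != e.2 ->
  (e.1 \in touched) && (e.2 \in touched).
Proof.
move=> eS e12.
have arc1 : arc_vec e e.1 != 0 by rewrite ffunE eqxx (negPf e12).
have arc2 : arc_vec e e.2 != 0 by rewrite ffunE eqxx [e.2 == e.1]eq_sym (negPf e12).
by rewrite (mem_touched eS arc1) (mem_touched eS arc2).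
Qed.

(* There are at least as many arcs as touched vertices, while all the incidence
   vectors lie in the sum-zero hyperplane. *)
Lemma incidence_relation_exists (F : fieldType) : S != finset.set0 ->
  (forall e, e \in S -> e.1 != e.2) ->
  exists2 r : 'rV[F]_#|S|, r != 0
    & forall v, \sum_i r 0 i * (arc_vec (enum_val i) v)%:~R = 0.
Proof.
case/set0Pn=> e0 e0S no_loop.
have endpoints e : e \in S -> (e.1 \in touched) && (e.2 \in touched).
  by move=> eS; rewrite touched_endpoints // no_loop.
pose M : 'M[F]_(#|S|, #|touched|) :=
  \matrix_(i, j) (arc_vec (enum_val i) (enum_val j))%:~R.
have row_sum0 : M *m const_mx 1 = 0 :> 'cV_#|S|.
  apply/matrixP => i j; rewrite !mxE; under eq_bigr do rewrite !mxE mulr1.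
  rewrite -(big_enum_val (fun v => (arc_vec (enum_val i) v)%:~R)) -rmorph_sum /=.
  have := vertex_sum_arc_vec [in touched] (enum_val i); rewrite /vertex_sum => ->.
  by have /andP[-> ->] := endpoints _ (enum_valP i); rewrite subrr.
have const1_neq0 : const_mx 1 != 0 :> 'cV[F]_#|touched|.
  have /andP[e0W _] := endpoints _ e0S.
  apply/cV0Pn; exists (enum_rank_in e0W e0.1).
  by rewrite mxE oner_eq0.
have [r r0 rM] := rowV_kernel_exists card_touched_le const1_neq0 row_sum0.
exists r => // v; have [vW|vW] := boolP (v \in touched); last first.
  apply: big1 => i _; have [->|iv] := eqVneq (arc_vec (enum_val i) v) 0.
    by rewrite mulr0.
  by rewrite (mem_touched (enum_valP i)) in vW.
move/rowP/(_ (enum_rank_in vW v)): rM; rewrite !mxE => rMv; rewrite -[RHS]rMv.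
by apply: eq_bigr => i _; rewrite mxE enum_rankK_in.
Qed.

Lemma circulation_exists (F : fieldType) : S != finset.set0 ->
  exists g : V * V -> F,
    [/\ exists e, g e != 0, forall e, e \notin S -> g e = 0
      & forall v, divergence g v = 0].
Proof.
move=> S0; case: (boolP [exists e in S, e.1 == e.2]) => [/exists_inP|no_loop].
  case=> e eS /eqP e12; exists (fun e' => (e' == e)%:R); split.
  - by exists e; rewrite eqxx oner_eq0.
  - by move=> e' e'S; case: eqVneq e'S => // ->; rewrite eS.
  - move=> v; rewrite /divergence (bigD1 e) //= ffunE e12 subrr mulr0 add0r big1 //.
    by move=> e' /negPf ->; rewrite mul0r.
have [e eS|r r0 r_rel] := incidence_relation_exists F S0.
  by have := exists_inPn no_loop e eS.
have [e0 e0S] := set0Pn _ S0.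
pose g e := if e \in S then r 0 (enum_rank_in e0S e) else 0.
exists g; split.
- have /rV0Pn[i ri] := r0; exists (enum_val i).
  by rewrite /g enum_valP enum_valK_in.
- by move=> e /negPf; rewrite /g => ->.
- move=> v; rewrite -[RHS](r_rel v) /divergence (bigID [in S]) /= [X in _ + X]big1.
    rewrite addr0 big_enum_val; apply: eq_bigr => i _.
    by rewrite /g enum_valP enum_valK_in.
  by move=> e /negPf; rewrite /g => ->; rewrite mul0r.
Qed.

End Circulation.

Definition fractional (R : archiRealFieldType) (E : finType) (f : E -> R) :
  {set E} := [set e | f e \isn't a Num.int]%SET.

Definition rounding_bounds (R : archiRealFieldType) (a x : R) : bool :=
  (Num.floor a)%:~R <= x <= (Num.ceil a)%:~R.

(* Junk value [0] when [b = 0]. *)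
Definition rounding_time (R : archiRealFieldType) (a b : R) : R :=
  ((if 0 < b then Num.ceil a else Num.floor a)%:~R - a) / b.

Section Rounding.
Variable R : archiRealFieldType.
Implicit Types a b x y s : R.

Lemma rounding_bounds_refl a : rounding_bounds a a.
Proof. by rewrite /rounding_bounds floor_le ceil_ge. Qed.

Lemma rounding_bounds_trans a x y :
  rounding_bounds a x -> rounding_bounds x y -> rounding_bounds a y.
Proof.
move=> /andP[ax xa] /andP[xy yx]; apply/andP; split.
  by apply: le_trans xy; rewrite ler_int floor_ge_int.
by apply: le_trans yx _; rewrite ler_int ceil_le_int.
Qed.

Lemma rounding_bounds_int a x : a \is a Num.int -> rounding_bounds a x -> x = a.
Proof.
by case/intrP=> n ->; rewrite /rounding_bounds intrKfloor intrKceil -eq_le => /eqP.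
Qed.

Lemma rounding_time_gt0 a b : a \isn't a Num.int -> b != 0 -> 0 < rounding_time a b.
Proof.
rewrite /rounding_time => aZ.
have floor_lt : (Num.floor a)%:~R < a by rewrite lt_neqAle -intrEfloor aZ floor_le.
have lt_ceil : a < (Num.ceil a)%:~R.
  by rewrite lt_neqAle eq_sym -intrEceil aZ ceil_ge.
case: (ltrgt0P b) => // b0 _; first by rewrite divr_gt0 ?subr_gt0.
by rewrite nmulr_rgt0 ?invr_lt0 ?subr_lt0.
Qed.

Lemma rounding_time_int a b : b != 0 -> a + rounding_time a b * b \is a Num.int.
Proof. by move=> b0; rewrite divfK // addrC subrK intr_int. Qed.

Lemma rounding_time_bounds a b s :
  0 <= s -> s <= rounding_time a b -> rounding_bounds a (a + s * b).
Proof.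
rewrite /rounding_time /rounding_bounds => s0.
have [fl cl] := (floor_le a, ceil_ge a).
case: (ltrgt0P b) => [b0|b0|-> _]; last by rewrite mulr0 addr0 fl cl.
- rewrite ler_pdivlMr // lerBrDl => ->.
  by rewrite (le_trans fl) // lerDl mulr_ge0 // ltW.
- rewrite ler_ndivlMr // lerBlDl => ->.
  by rewrite (le_trans _ cl) // gerDl mulr_ge0_le0 // ltW.
Qed.

Lemma round_along (E : finType) (f g : E -> R) :
  (exists e, g e != 0) -> (forall e, e \notin fractional f -> g e = 0) ->
  exists2 t, 0 <= t
    & (forall e, rounding_bounds (f e) (f e + t * g e)) /\
      exists2 e, e \in fractional f & f e + t * g e \is a Num.int.
Proof.
move=> [e0 ge0] g_supp.
have fracP e : g e != 0 -> e \in fractional f.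
  by move=> ge; apply: contraNT ge => /g_supp ->.
pose tau e := rounding_time (f e) (g e).
have [e1 ge1 tau_min] := arg_minP (P := fun e => g e != 0) tau ge0.
have tau_ge0 : 0 <= tau e1.
  by rewrite ltW // rounding_time_gt0 //; have := fracP _ ge1; rewrite inE.
exists (tau e1) => //; split=> [e|]; last first.
  by exists e1; [apply: fracP|apply: rounding_time_int].
have [->|ge] := eqVneq (g e) 0; first by rewrite mulr0 addr0 rounding_bounds_refl.
exact/rounding_time_bounds/tau_min.
Qed.

Variable V : finType.
Implicit Types (c f g : V * V -> R).

Lemma fractional_no_leaf f : (forall v, divergence f v \is a Num.int) ->
  forall e v, e \in fractional f -> arc_vec e v != 0 ->
  exists2 e', e' \in fractional f & (e' != e) && (arc_vec e' v != 0).
Proof.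
move=> f_int e v eF ev; apply/exists_inP; apply: contraT => /exists_inPn no_other.
have := f_int v; rewrite /divergence (bigD1 e) //= rpredDr; last first.
  apply: rpred_sum => e' e'e; have [e'F|] := boolP (e' \in fractional f).
    by have := no_other _ e'F; rewrite e'e /= negbK => /eqP ->; rewrite mulr0 rpred0.
  by rewrite inE negbK => fe'; rewrite rpredM // intr_int.
move: eF ev; rewrite inE ffunE => /negPf fe.
by case: (v == e.1); case: (v == e.2) => //;
  rewrite ?subr0 ?sub0r ?mulrN ?rpredN mulr1 fe.
Qed.

Lemma fractional_descent f c :
  (forall v, divergence f v \is a Num.int) -> fractional f != finset.set0 ->
  exists g, [/\ exists e, g e != 0, forall e, e \notin fractional f -> g e = 0,
                forall v, divergence g v = 0 & \sum_e c e * g e <= 0].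
Proof.
move=> f_int frac0.
have [g [[e ge] g_supp g_div]] :=
  circulation_exists (fractional_no_leaf f_int) R frac0.
have [cg|cg] := lerP (\sum_e c e * g e) 0; first by exists g; split=> //; exists e.
exists (fun e => -1 * g e); split.
- by exists e; rewrite mulN1r oppr_eq0.
- by move=> e' /g_supp ->; rewrite mulr0.
- by move=> v; rewrite divergenceZ g_div mulr0.
- by under eq_bigr do rewrite mulrCA; rewrite -mulr_sumr mulN1r oppr_le0 ltW.
Qed.

Lemma flow_rounding_step f c :
  (forall v, divergence f v \is a Num.int) -> fractional f != finset.set0 ->
  exists f', [/\ fractional f' \proper fractional f,
                 forall e, rounding_bounds (f e) (f' e),
                 forall v, divergence f' v = divergence f v
               & \sum_e c e * f' e <= \sum_e c e * f e].
Proof.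
move=> f_int frac0.
have [g [g0 g_supp g_div g_cost]] := fractional_descent c f_int frac0.
have [t t0 [f'_bounds [e eF f'e]]] := round_along g0 g_supp.
exists (fun e => f e + t * g e); split=> //.
- apply/properP; split; last by exists e; rewrite // inE f'e.
  apply/fintype.subsetP => e'; rewrite !inE; apply: contraNN => fe'.
  by rewrite (rounding_bounds_int fe' (f'_bounds e')).
- by move=> v; rewrite divergenceD divergenceZ g_div mulr0 addr0.
- under eq_bigr do rewrite mulrDr mulrCA.
  by rewrite big_split /= -mulr_sumr gerDl mulr_ge0_le0.
Qed.

Lemma flow_rounding f c : (forall v, divergence f v \is a Num.int) ->
  exists g : V * V -> int,
    [/\ forall e, rounding_bounds (f e) (g e)%:~R,
        forall v, divergence f v = (divergence g v)%:~R
      & \sum_e c e * (g e)%:~R <= \sum_e c e * f e].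
Proof.
have [n] := ubnP #|fractional f|; elim: n f => // n IHn f; rewrite ltnS.
move=> leFn f_int.
have [frac0|frac0] := eqVneq (fractional f) finset.set0.
  have fE e : f e = (Num.floor (f e))%:~R.
    apply/esym/eqP; rewrite -intrEfloor; apply: contraT => fe.
    by have := finset.in_set0 e; rewrite -frac0 inE fe.
  exists (fun e => Num.floor (f e)); split=> [e|v|].
  - by rewrite -fE rounding_bounds_refl.
  - by rewrite rmorph_sum /=; apply: eq_bigr => e _; rewrite intrM -fE intz.
  - by under eq_bigr do rewrite -fE.
have [f' [f'_frac f'_bounds f'_div f'_cost]] := flow_rounding_step c f_int frac0.
have [|v|g [g_bounds g_div g_cost]] := IHn f'.
- exact: leq_trans (proper_card f'_frac) leFn.
- by rewrite f'_div.
exists g; split=> [e|v|]; first exact: rounding_bounds_trans (g_bounds e).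
  by rewrite -f'_div.
exact: le_trans f'_cost.
Qed.

End Rounding.

(** * Integer flows and the edge lattice *)

Definition edge_vecs (G : sgraph) : {pred {ffun G -> int}} :=
  [pred x | [exists e : G * G, adj e.1 e.2 && (x == arc_vec e)]].
Arguments edge_vecs : clear implicits.

Notation edge_lattice G := (word_span (edge_vecs G)).
Notation edge_norm G := (word_norm (edge_vecs G)).

Definition flow_sum (V : finType) (f : {ffun V * V -> nat}) : {ffun V -> int} :=
  \sum_e arc_vec e *+ f e.

Fact flow_sum_is_nmod_morphism (V : finType) : nmod_morphism (@flow_sum V).
Proof.
split=> [|f g]; first by rewrite /flow_sum big1 // => e _; rewrite ffunE.
by rewrite /flow_sum -big_split; apply: eq_bigr => e _; rewrite ffunE mulrnDr.
Qed.
HB.instance Definition _ (V : finType) :=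
  GRing.isNmodMorphism.Build {ffun V * V -> nat} {ffun V -> int} (@flow_sum V)
    (@flow_sum_is_nmod_morphism V).

Definition flow_size (E : finType) (f : {ffun E -> nat}) : nat := \sum_e f e.

Fact flow_size_is_nmod_morphism (E : finType) : nmod_morphism (@flow_size E).
Proof.
split=> [|f g]; first by rewrite /flow_size big1 // => e _; rewrite ffunE.
by rewrite /flow_size -big_split; apply: eq_bigr => e _; rewrite ffunE.
Qed.
HB.instance Definition _ (E : finType) :=
  GRing.isNmodMorphism.Build {ffun E -> nat} nat (@flow_size E)
    (@flow_size_is_nmod_morphism E).

Lemma flow_le_size (E : finType) (f : {ffun E -> nat}) e : (f e <= flow_size f)%N.
Proof. by rewrite /flow_size (bigD1 e) //= leq_addr. Qed.

Definition bounded_flow (E : finType) N (a : {ffun E -> 'I_N}) : {ffun E -> nat} :=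
  [ffun e => val (a e)].

Lemma bounded_flow_inj (E : finType) N : injective (@bounded_flow E N).
Proof.
move=> a b /ffunP ab; apply/ffunP => e; apply: val_inj.
by have := ab e; rewrite !ffunE.
Qed.

Lemma bounded_flow_surj (E : finType) N (f : {ffun E -> nat}) :
  (flow_size f < N)%N -> exists a : {ffun E -> 'I_N}, bounded_flow a = f.
Proof.
move=> fN; have feN e : (f e < N)%N := leq_ltn_trans (flow_le_size f e) fN.
by exists [ffun e => Ordinal (feN e)]; apply/ffunP => e; rewrite !ffunE.
Qed.

Lemma graded_finite_flows (E : finType) (C : set {ffun E -> nat}) :
  graded_finite C (@flow_size E).
Proof.
move=> N; apply: (@sub_finite_set _ _ (range (@bounded_flow E N))).
  by move=> f [_ /bounded_flow_surj[a <-]]; exists a.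
exact/finite_image/finite_finset.
Qed.

Lemma flow_sum_divergence (R : pzRingType) (V : finType)
    (f : {ffun V * V -> nat}) v :
  (flow_sum f v)%:~R = divergence (fun e => (f e)%:R : R) v.
Proof.
rewrite /flow_sum sum_ffunE rmorph_sum; apply: eq_bigr => e _ /=.
by rewrite ffunMnE rmorphMn /= mulr_natl.
Qed.

Lemma nat_flow_rounding (R : archiRealFieldType) (V : finType) (f : V * V -> R) :
  (forall e, 0 <= f e) -> (forall v, divergence f v \is a Num.int) ->
  exists g : {ffun V * V -> nat},
    [/\ forall e, rounding_bounds (f e) (g e)%:R,
        forall v, divergence f v = (flow_sum g v)%:~R
      & (flow_size g)%:R <= \sum_e f e].
Proof.
move=> f0 f_int; have [g [g_bounds g_div g_cost]] := flow_rounding (fun=> 1) f_int.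
have gE e : (g e)%:~R = `|g e|%N%:R :> R.
  rewrite pmulrn gez0_abs // -(ler_int R).
  by have /andP[+ _] := g_bounds e; apply: le_trans; rewrite ler_int floor_ge_int f0.
exists [ffun e => `|g e|%N]; split=> [e|v|]; first by rewrite ffunE -gE.
  rewrite g_div flow_sum_divergence rmorph_sum; apply: eq_bigr => e _ /=.
  by rewrite [X in X%:R]ffunE -gE rmorphM /= intz.
under [leRHS]eq_bigr do rewrite -[f _]mul1r.
apply: le_trans g_cost; rewrite /flow_size natr_sum le_eqVlt; apply/orP; left.
by apply/eqP/eq_bigr => e _; rewrite ffunE mul1r gE.
Qed.

Section EdgeFlow.
Variable G : sgraph.
Implicit Types (f g h : {ffun G * G -> nat}) (x : {ffun G -> int}).

Definition edge_flow f : Prop := forall e, ~~ adj e.1 e.2 -> f e = 0%N.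

Lemma edge_flowD f g : edge_flow f -> edge_flow g -> edge_flow (f + g).
Proof. by move=> f_edge g_edge e ne; rewrite ffunE f_edge // g_edge. Qed.

Lemma edge_flowDl f g : edge_flow (f + g) -> edge_flow f.
Proof.
by move=> fg e /fg; rewrite ffunE => /eqP; rewrite addn_eq0 => /andP[/eqP].
Qed.

Lemma edge_vecsP x :
  reflect (exists2 e, adj e.1 e.2 & x = arc_vec e) (x \in edge_vecs G).
Proof.
apply: (iffP existsP) => [[e /andP[e_adj /eqP]]|[e e_adj ->]]; exists e => //.
by rewrite e_adj /=.
Qed.

Lemma edge_vecs_arc e : adj e.1 e.2 -> arc_vec e \in edge_vecs G.
Proof. by move=> e_adj; apply/edge_vecsP; exists e. Qed.

Lemma edge_vecsN : {in edge_vecs G, forall x, - x \in edge_vecs G}.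
Proof.
move=> _ /edge_vecsP[e e_adj ->]; apply/edge_vecsP; exists (e.2, e.1).
  by rewrite adj_sym.
by apply/ffunP => v; rewrite !ffunE opprB.
Qed.

Lemma flow_of_word (s : seq {ffun G -> int}) : all [in edge_vecs G] s ->
  exists f, [/\ edge_flow f, flow_sum f = \sum_(x <- s) x & flow_size f = size s].
Proof.
elim: s => [_|x s IHs /= /andP[/edge_vecsP[a a_adj ->]]].
  by exists 0; split; rewrite ?raddf0 ?big_nil // => e _; rewrite ffunE.
case/IHs=> f [f_edge f_sum f_size].
pose delta : {ffun G * G -> nat} := [ffun e => (e == a : nat)].
have delta_sum : flow_sum delta = arc_vec a.
  rewrite /flow_sum (bigD1 a) //= ffunE eqxx big1 ?addr0 // => e /negPf.
  by rewrite ffunE => ->.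
have delta_size : flow_size delta = 1%N.
  rewrite /flow_size (bigD1 a) //= ffunE eqxx big1 // => e /negPf.
  by rewrite ffunE => ->.
exists (delta + f); split.
- by apply: edge_flowD => // e; rewrite ffunE; case: eqP => // ->; rewrite a_adj.
- by rewrite raddfD /= delta_sum f_sum big_cons.
- by rewrite raddfD /= delta_size f_size.
Qed.

Lemma word_of_flow f : edge_flow f ->
  exists s, [/\ all [in edge_vecs G] s, \sum_(x <- s) x = flow_sum f
              & size s = flow_size f].
Proof.
move=> f_edge.
exists (flatten [seq nseq (f e) (arc_vec e) | e <- enum {: G * G}]); split.
- apply/allP => _ /flattenP[_ /mapP[e _ ->] /nseqP[-> fe]]; apply: edge_vecs_arc.
  by apply: contraTT fe => /f_edge ->.
- rewrite big_flatten big_map big_enum; apply: eq_bigr => e _.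
  by rewrite big_nseq iter_addr_0.
- rewrite size_flatten /shape -map_comp sumnE big_map big_enum.
  by apply: eq_bigr => e _; rewrite /= size_nseq.
Qed.

Lemma edge_lattice_flow f : edge_flow f -> edge_lattice G (flow_sum f).
Proof. by move=> /word_of_flow[s [Ss <- _]]; apply: word_span_sum. Qed.

Lemma edge_norm_flow_le f : edge_flow f ->
  (edge_norm G (flow_sum f) <= flow_size f)%N.
Proof. by move=> /word_of_flow[s [Ss <- <-]]; apply: word_norm_le. Qed.

Lemma edge_norm_flow x : edge_lattice G x ->
  exists f, [/\ edge_flow f, flow_sum f = x & flow_size f = edge_norm G x].
Proof. by move=> /word_normP[s [/flow_of_word[f [? ? ?]] <- <-]]; exists f. Qed.

Lemma graded_finite_edge_lattice : graded_finite (edge_lattice G) (edge_norm G).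
Proof.
move=> N; have finN := graded_finite_flows [set: {ffun G * G -> nat}] N.
apply: sub_finite_set (finite_image (@flow_sum G) finN).
move=> x [/edge_norm_flow[f [f_edge <- f_size]] /= xN]; exists f => //.
by split; rewrite //= f_size.
Qed.

Lemma flow_split f x k : edge_flow f -> flow_sum f = x *+ k.+1 ->
  exists g h, [/\ edge_flow g, edge_flow h, f = g + h, flow_sum g = x
                & flow_sum h = x *+ k].
Proof.
move=> f_edge f_sum; pose q (e : G * G) : rat := (f e)%:R / k.+1%:R.
have k0 : k.+1%:R != 0 :> rat by rewrite pnatr_eq0.
have q_div v : divergence q v = (x v)%:~R.
  apply: (mulfI k0); rewrite [RHS]mulr_natl -rmorphMn /= -ffunMnE -f_sum.
  rewrite flow_sum_divergence /divergence mulr_sumr; apply: eq_bigr => e _.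
  by rewrite /q mulrA mulrCA divff // mulr1.
have [e|v|g [g_bounds g_div _]] := @nat_flow_rounding rat G q.
- by rewrite divr_ge0 ?ler0n.
- by rewrite q_div intr_int.
have gf e : (g e <= f e)%N.
  have /andP[_ ge] := g_bounds e; rewrite -(ler_nat rat) (le_trans ge) //.
  rewrite pmulrn ler_int ceil_le_int -pmulrn ler_pdivrMr ?ltr0n //.
  by rewrite ler_peMr ?ler0n // ler1n.
pose h := [ffun e => (f e - g e)%N] : {ffun G * G -> nat}.
have fgh : f = g + h by apply/ffunP => e; rewrite !ffunE /= [RHS]subnKC.
have g_sum : flow_sum g = x.
  by apply/ffunP => v; apply: (@intr_inj rat); rewrite -g_div q_div.
exists g, h; split=> //.
- by apply: (@edge_flowDl _ h); rewrite -fgh.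
- by apply: (@edge_flowDl _ g); rewrite addrC -fgh.
- by apply: (addrI x); rewrite -mulrS -f_sum fgh raddfD /= g_sum.
Qed.

Lemma edge_norm_double x : edge_lattice G x ->
  ((edge_norm G x).*2 <= edge_norm G (x + x))%N.
Proof.
move=> x_lat; have [f [f_edge f_sum <-]] := edge_norm_flow (word_spanD x_lat x_lat).
have [g [h [g_edge h_edge -> g_sum h_sum]]] := flow_split (k := 1) f_edge f_sum.
rewrite raddfD -addnn leq_add //.
  by rewrite -[in leqLHS]g_sum edge_norm_flow_le.
by rewrite -[x in leqLHS]mulr1n -h_sum edge_norm_flow_le.
Qed.

End EdgeFlow.

(** * Flows with a prescribed set of supports *)

Definition flow_support (E : finType) (f : {ffun E -> nat}) : {set E} :=
  [set e | (0 < f e)%N]%SET.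

Section SupportGeneratingFunction.
Variables (R : idomainType) (E : finType).
Implicit Types (S : {set E}) (N : nat).

Lemma genfun_bounded_flows (C : pred {ffun E -> nat}) N :
  \sum_(a : {ffun E -> 'I_N} | C (bounded_flow a)) 'X^(flow_size (bounded_flow a))
    = genfun R [set f | C f] (@flow_size E) N %[modX N].
Proof.
have finB : finite_set (@bounded_flow E N @` [set a | C (bounded_flow a)]).
  exact/finite_image/finite_finset.
rewrite -(genfun_widen R finB).
- rewrite fsbig_image; last by move=> a b _ _; apply: bounded_flow_inj.
  rewrite (bigfs _ (P := fun a => C (bounded_flow a))) ?index_enum_uniq //.
  by move=> a _; rewrite mem_index_enum.
- by move=> _ [a Ca <-].
- by move=> f [Cf /bounded_flow_surj[a fE]]; exists a; rewrite //= fE.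
Qed.

Lemma sum_bounded_flows_support S N :
  \sum_(a : {ffun E -> 'I_N} | flow_support (bounded_flow a) == S)
      'X^(flow_size (bounded_flow a))
    = \prod_e \sum_(k < N | (0 < k)%N == (e \in S)) 'X^k :> {poly R}.
Proof.
rewrite bigA_distr_big_dep; apply: eq_big => [a|a _].
  apply/eqP/familyP => [aS e|aS]; first by rewrite unfold_in -aS inE ffunE.
  by apply/setP => e; have := aS e; rewrite unfold_in inE ffunE => /eqP.
by rewrite /flow_size -prodrXr; apply: eq_bigr => e _; rewrite ffunE.
Qed.

Lemma geometric_support (b : bool) N :
  (1 - 'X) * \sum_(k < N | (0 < k)%N == b) ('X^k : {poly R})
    = (if b then 'X else 1 - 'X) %[modX N].
Proof.
case: N => [|N]; first by rewrite !take_poly0l.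
case: b; rewrite big_mkcond big_ord_recl /=.
  rewrite add0r; under eq_bigr do rewrite exprS.
  rewrite -mulr_sumr mulrCA -(big_mkord predT (fun k => 'X^k)) geometric_sum //.
  by rewrite expr0 mulrBr mulr1 -exprS -['X^_]mul1r eqmodX_subMXn.
by rewrite big1 ?addr0 ?expr0 ?mulr1 // => i _.
Qed.

Lemma genfun_support (Delta : pred {set E}) N :
  (1 - 'X) ^+ #|E| * genfun R [set f | Delta (flow_support f)] (@flow_size E) N
    = \sum_(S | Delta S) \prod_e (if e \in S then 'X else 1 - 'X) %[modX N].
Proof.
have := genfun_bounded_flows (fun f => Delta (flow_support f)) N.
move=> /(eqmodXMl ((1 - 'X) ^+ #|E|)) <-.
rewrite (partition_big (fun a => flow_support (bounded_flow a)) Delta) //= mulr_sumr.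
apply: eqmodX_sum => S DS.
rewrite (eq_bigl (fun a => flow_support (bounded_flow a) == S)); last first.
  by move=> a; case: eqP => [->|]; rewrite ?DS ?andbF.
rewrite sum_bounded_flows_support -prodr_const -big_split /=.
by apply: eqmodX_prod => e _; apply: geometric_support.
Qed.

End SupportGeneratingFunction.

(** * Canonical flows *)

Section LexicographicOrder.
Variable E : finType.
Implicit Types f g h : {ffun E -> nat}.

Definition lex_key f : seqlexi nat := flow_size f :: codom f.

Definition lex_le f g : bool := (lex_key f <= lex_key g)%O.

Lemma lex_le_anti f g : lex_le f g -> lex_le g f -> f = g.
Proof.
move=> fg gf; have /eqP[_] : lex_key f == lex_key g by rewrite eq_le; apply/andP.
by rewrite !codom_ffun => /val_inj/(can_inj fgraphK).
Qed.

Lemma lex_le_size f g : lex_le f g -> (flow_size f <= flow_size g)%N.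
Proof. exact: lexi_lehead. Qed.

Let lexi_add2r (r : seq E) f g h :
  (([seq (f + h) e | e <- r] : seqlexi nat) <= [seq (g + h) e | e <- r])%O
  = (([seq f e | e <- r] : seqlexi nat) <= [seq g e | e <- r])%O.
Proof.
by elim: r => //= e r IHr; rewrite !lexi_cons IHr !ffunE !leEnat !leq_add2r.
Qed.

Lemma lex_le_add2r h f g : lex_le (f + h) (g + h) = lex_le f g.
Proof. by rewrite /lex_le !lexi_cons !raddfD /= !leEnat !leq_add2r lexi_add2r. Qed.

Lemma lex_leD f f' g g' : lex_le f g -> lex_le f' g' -> lex_le (f + f') (g + g').
Proof.
move=> fg f'g'; apply: (@le_trans _ _ (lex_key (g + f'))).
  by rewrite -/(lex_le _ _) lex_le_add2r.
by rewrite -/(lex_le _ _) ![g + _]addrC lex_le_add2r.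
Qed.

Lemma lex_le0 f : lex_le 0 f.
Proof.
rewrite /lex_le lexi_cons raddf0 leEnat /=; apply/implyP => _.
rewrite /codom /image_mem; elim: (enum E) => //= e r IHr.
by rewrite lexi_cons ffunE leEnat /= IHr implybT.
Qed.

Lemma lex_le_min (P : set {ffun E -> nat}) :
  P !=set0 -> exists2 f, P f & forall g, P g -> lex_le f g.
Proof.
case=> f0 Pf0; pose A := fset_set (sublevel P (@flow_size E) (flow_size f0).+1).
have AP f : f \in A <-> P f /\ (flow_size f <= flow_size f0)%N.
  by rewrite in_fset_set ?inE //; apply: graded_finite_flows.
have A0 : f0 \in A by apply/AP.
have [f _ fmin] :=
  arg_minP (fun f : A => lex_key (val f)) (isT : xpredT [` A0]%fset).
have [Pf fsize] := (AP _).1 (valP f); exists (val f) => // g Pg.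
have [gsize|gsize] := leqP (flow_size g) (flow_size f0).
  have gA : g \in A by apply/AP.
  exact: (fmin [` gA]%fset).
rewrite /lex_le lexi_cons !leEnat; have lt_size := leq_ltn_trans fsize gsize.
by rewrite (ltnW lt_size) leqNgt lt_size.
Qed.

End LexicographicOrder.

Section CanonicalFlow.
Variable G : sgraph.
Implicit Types f g h : {ffun G * G -> nat}.

(* Asking for minimality of all multiples makes the condition depend on the
   support of [f] only. *)
Definition canonical_flow f : Prop :=
  edge_flow f /\
  forall k g, edge_flow g -> flow_sum g = flow_sum f *+ k -> lex_le (f *+ k) g.

(* A large multiple of [f] dominates [g *+ k], and translation by the difference
   [d] preserves the order. *)
Lemma canonical_flow_support f g :
  flow_support g \subset flow_support f -> canonical_flow f -> canonical_flow g.
Proof.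
move=> /fintype.subsetP supp [f_edge fmin].
have f_gt0 e : (0 < g e -> 0 < f e)%N.
  by move=> ge; have := supp e; rewrite !inE ge; apply.
split=> [e ne|k h h_edge h_sum].
  by apply/eqP; rewrite -leqn0 leqNgt; apply/negP => /f_gt0; rewrite f_edge.
pose K := (k * flow_size g)%N.
have kgf e : ((g *+ k) e <= (f *+ K) e)%N.
  have natrMn (m n : nat) : m *+ n = (m * n)%N by rewrite -iter_addr_0 iter_addn_0.
  rewrite !ffunMnE !natrMn; have [->//|ge] := posnP (g e).
  rewrite /K mulnCA [leqLHS]mulnC leq_mul2l (leq_trans (flow_le_size g e)) ?orbT //.
  by rewrite leq_pmull // f_gt0.
pose d : {ffun G * G -> nat} := [ffun e => ((f *+ K) e - (g *+ k) e)%N].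
have fE : f *+ K = g *+ k + d.
  by apply/ffunP => e; rewrite [RHS]ffunE ffunE /= [RHS]subnKC.
have d_edge : edge_flow d.
  apply: (@edge_flowDl _ _ (g *+ k)); rewrite addrC -fE => e ne.
  by rewrite ffunMnE f_edge // mul0rn.
rewrite -(lex_le_add2r d) -fE; apply: fmin; first exact: edge_flowD.
by rewrite -raddfMn fE !raddfD /= h_sum raddfMn.
Qed.

Lemma canonical_flow_exists x : edge_lattice G x ->
  exists2 f, canonical_flow f & flow_sum f = x.
Proof.
move=> /edge_norm_flow[f0 [f0_edge f0_sum _]].
have [|f [f_edge f_sum] fmin] :=
  @lex_le_min _ [set f : {ffun G * G -> nat} | edge_flow f /\ flow_sum f = x].
  by exists f0.
exists f => //; split=> // k; rewrite f_sum; elim: k => [|k IHk] g g_edge g_sum.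
  exact: lex_le0.
have [g1 [g2 [g1_edge g2_edge -> g1_sum g2_sum]]] := flow_split g_edge g_sum.
by rewrite mulrS lex_leD ?fmin ?IHk.
Qed.

Lemma canonical_flow_min f g : canonical_flow f -> edge_flow g ->
  flow_sum g = flow_sum f -> lex_le f g.
Proof. by move=> [_ fmin] g_edge g_sum; apply: (fmin 1). Qed.

Lemma canonical_flow_norm f : canonical_flow f ->
  edge_norm G (flow_sum f) = flow_size f.
Proof.
move=> f_can; have [f_edge _] := f_can.
apply/eqP; rewrite eqn_leq edge_norm_flow_le //=.
have [g [g_edge g_sum <-]] := edge_norm_flow (edge_lattice_flow f_edge).
exact/lex_le_size/canonical_flow_min.
Qed.

Lemma canonical_flow_bij :
  set_bij [set f | canonical_flow f] (edge_lattice G) (@flow_sum G).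
Proof.
split.
- by move=> f /= [f_edge _]; apply: edge_lattice_flow.
- move=> f g; rewrite !inE /= => f_can g_can fg; have [f_edge _] := f_can.
  by have [g_edge _] := g_can; apply: lex_le_anti; apply: canonical_flow_min.
- by move=> x /canonical_flow_exists[f]; exists f.
Qed.

Lemma genfun_edge_lattice_rational (R : idomainType) :
  exists p : {poly R}, forall N,
    (1 - 'X) ^+ #|{: G * G}| * genfun R (edge_lattice G) (edge_norm G) N = p
      %[modX N].
Proof.
pose indicator (S : {set G * G}) : {ffun G * G -> nat} :=
  [ffun e => (e \in S : nat)].
pose Delta (S : {set G * G}) := `[< canonical_flow (indicator S) >].
have canonicalE : [set f | canonical_flow f] = [set f | Delta (flow_support f)].
  have indicator_support f :
      flow_support (indicator (flow_support f)) = flow_support f.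
    by apply/setP => e; rewrite !inE ffunE inE; case: (f e).
  apply/seteqP; split=> f /= => [f_can|/asboolP f_can]; first apply/asboolP;
    by apply: canonical_flow_support f_can; rewrite indicator_support.
exists (\sum_(S | Delta S) \prod_e (if e \in S then 'X else 1 - 'X)) => N.
rewrite (genfun_bij _ _ canonical_flow_bij canonical_flow_norm) canonicalE.
exact: genfun_support.
Qed.

End CanonicalFlow.

(** * Lattice points of symmetric edge polytopes *)

Lemma conv_hull_imageP (R : realType) (V I : finType) (A : pred I)
    (p : I -> {ffun V -> R}) (x : {ffun V -> R}) :
  conv_hull [set p i | i in [set i | A i]] x <->
  exists a : I -> R,
    [/\ forall i, 0 <= a i, forall i, ~~ A i -> a i = 0, \sum_i a i = 1
      & x = [ffun v => \sum_i a i * p i v]].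
Proof.
split=> [[n [q [b [qA b0 b1 ->]]]]|[a [a0 aA a1 ->]]].
  have /boolp.choice[r rq] : forall k, exists i, A i /\ p i = q k.
    by move=> k; have [i Ai pik] := qA k; exists i.
  pose a i := \sum_(k | r k == i) b k.
  have sum_a (F : I -> R) : \sum_i a i * F i = \sum_k b k * F (r k).
    rewrite [RHS](partition_big r predT) //=; apply: eq_bigr => i _.
    by rewrite mulr_suml; apply: eq_bigr => k /eqP ->.
  exists a; split.
  - by move=> i; apply: sumr_ge0.
  - move=> i nAi; apply: big1 => k /eqP rk.
    by have [Ark _] := rq k; rewrite rk (negPf nAi) in Ark.
  - have := sum_a (fun=> 1); under eq_bigr do rewrite mulr1; move=> ->.
    by under eq_bigr do rewrite mulr1.
  - apply/ffunP => v; rewrite !ffunE sum_a; apply: eq_bigr => k _.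
    by rewrite (rq k).2.
have sum_A (F : I -> R) :
    \sum_(k < #|A|) a (enum_val k) * F (enum_val k) = \sum_i a i * F i.
  rewrite -(big_enum_val (fun i => a i * F i)) [RHS](bigID A) /= [X in _ + X]big1.
    by rewrite addr0.
  by move=> i /aA ->; rewrite mul0r.
exists #|A|, (fun k => p (enum_val k)), (fun k => a (enum_val k)); split=> //.
- by move=> k; exists (enum_val k) => //; apply: (enum_valP k).
- rewrite -a1; have := sum_A (fun=> 1).
  by under eq_bigr do rewrite mulr1; under [RHS]eq_bigr do rewrite mulr1.
- by apply/ffunP => v; rewrite !ffunE (sum_A (fun i => p i v)).
Qed.

Definition real_point (R : realType) (V : finType) (x : {ffun V -> int}) :
  {ffun V -> R} := [ffun v => (x v)%:~R].
Arguments real_point : clear implicits.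

Lemma real_point_inj (R : realType) (V : finType) : injective (real_point R V).
Proof.
by move=> x y /ffunP xy; apply/ffunP => v; have := xy v; rewrite !ffunE => /intr_inj.
Qed.

Lemma is_hstarP (R : realType) (V : finType) (P : set {ffun V -> R}) d
    (h : {poly R}) :
  is_hstar P d h <->
  forall N, h = (1 - 'X) ^+ d.+1 * \poly_(j < N) (ehrhart P j)%:R %[modX N].
Proof.
have coefE N n : (n < N)%N ->
    ((1 - 'X) ^+ d.+1 * \poly_(j < N) (ehrhart P j)%:R : {poly R})`_n =
    \sum_(i < n.+1) ((1 - 'X) ^+ d.+1 : {poly R})`_i * (ehrhart P (n - i))%:R.
  move=> nN; rewrite coefM; apply: eq_bigr => i _.
  by rewrite coef_poly (leq_ltn_trans (leq_subr _ _) nN).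
split=> [hP N|hP n]; first by apply/eqmodXP => n nN; rewrite coefE.
by have /eqmodXP/(_ n (leqnn _)) := hP n.+1; rewrite coefE.
Qed.

Section LatticePoints.
Variables (R : realType) (G : sgraph).
Implicit Types (f : G * G -> R) (x : {ffun G -> R}) (z : {ffun G -> int}).

Definition real_edge_flow f : Prop :=
  (forall e, 0 <= f e) /\ (forall e, ~~ adj e.1 e.2 -> f e = 0).

Lemma sym_edge_polytopeP x :
  sym_edge_polytope R G x <->
  exists f, [/\ real_edge_flow f, \sum_e f e = 1 & x = [ffun v => divergence f v]].
Proof.
have -> : sym_edge_polytope R G = conv_hull
    [set real_point R G (arc_vec e) | e in [set e : G * G | adj e.1 e.2]].
  have unit_vecB v w : unit_vec R v - unit_vec R w = real_point R G (arc_vec (v, w)).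
    by apply/ffunP => u; rewrite !ffunE rmorphB /= !rmorph_nat.
  congr conv_hull; apply/seteqP; split=> y [].
    by move=> v [w [vw ->]]; exists (v, w).
  by case=> v w vw <-; exists v, w.
have div_conv f : [ffun v => divergence f v] =
    [ffun v => \sum_e f e * real_point R G (arc_vec e) v].
  apply/ffunP => v; rewrite !ffunE; apply: eq_bigr => e _.
  by rewrite [X in _ = _ * X]ffunE.
split=> [/(conv_hull_imageP (fun e => adj e.1 e.2))[f [f0 f_adj f1 ->]]|].
  by exists f; rewrite div_conv.
case=> f [[f0 f_adj] f1 ->]; apply/(conv_hull_imageP (fun e => adj e.1 e.2)).
by exists f; rewrite div_conv.
Qed.

Variables (v w : G).
Hypothesis vw : adj v w.

(* The opposite arcs (v, w) and (w, v) cancel. *)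
Lemma pad_real_edge_flow f (s : R) : real_edge_flow f -> \sum_e f e <= s ->
  exists f', [/\ real_edge_flow f', \sum_e f' e = s
               & forall u, divergence f' u = divergence f u].
Proof.
move=> [f0 f_adj] fs; pose c := (s - \sum_e f e) / 2.
have c0 : 0 <= c by rewrite divr_ge0 ?subr_ge0.
pose pad e : R := (e == (v, w))%:R + (e == (w, v))%:R.
have sum_pad (F : G * G -> R) : \sum_e pad e * F e = F (v, w) + F (w, v).
  have sum_delta a : \sum_e (e == a)%:R * F e = F a.
    rewrite (bigD1 a) //= eqxx mul1r big1 ?addr0 // => e /negPf ->.
    by rewrite mul0r.
  by under eq_bigr do rewrite mulrDl; rewrite big_split /= !sum_delta.
exists (fun e => f e + c * pad e); split.
- split=> e; first by rewrite addr_ge0 // mulr_ge0 // addr_ge0.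
  move=> ne; rewrite f_adj // /pad; case: eqP ne => [->|_]; first by rewrite vw.
  case: eqP => [->|_ _]; first by rewrite /= adj_sym vw.
  by rewrite !mulr0n addr0 mulr0 addr0.
- have pad_size : \sum_e pad e = 2.
    by rewrite -[RHS](sum_pad (fun=> 1)); apply: eq_bigr => e _; rewrite mulr1.
  by rewrite big_split -mulr_sumr /= pad_size divfK ?pnatr_eq0 // addrC subrK.
- move=> u; rewrite divergenceD divergenceZ /divergence sum_pad !ffunE.
  by rewrite -rmorphD /= -opprB addNr mulr0 addr0.
Qed.

Lemma dilate_pointsP j x :
  dilate_points (sym_edge_polytope R G) j x <->
  int_lattice R G x /\
  exists f, [/\ real_edge_flow f, \sum_e f e <= j%:R
             & x = [ffun u => divergence f u]].
Proof.
split=> [[[y /sym_edge_polytopeP[f [[f0 f_adj] f1 ->]] <-] x_int]|].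
  split=> //; exists (fun e => j%:R * f e); split.
  - by split=> e; [rewrite mulr_ge0|move=> /f_adj ->; rewrite mulr0].
  - by rewrite -mulr_sumr f1 mulr1.
  - by apply/ffunP => u; rewrite !ffunE divergenceZ.
move=> [x_int [f [f_edge fj xf]]]; split=> //.
have [j0|j0] := posnP j.
  rewrite j0 in fj.
  have zero_flow : real_edge_flow (fun=> 0) by split.
  have [|g [g_edge g1 g_div]] := pad_real_edge_flow (s := 1) zero_flow.
    by rewrite big1 // ler01.
  exists [ffun u => divergence g u]; first by apply/sym_edge_polytopeP; exists g.
  have f0 e : f e = 0.
    have [f_ge0 _] := f_edge; apply/eqP; rewrite eq_le f_ge0 andbT.
    by apply: le_trans fj; rewrite (bigD1 e) //= lerDl sumr_ge0.
  apply/ffunP => u; rewrite xf !ffunE j0 mul0r /divergence big1 // => e _.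
  by rewrite f0 mul0r.
have [g [[g0 g_adj] gj g_div]] := pad_real_edge_flow f_edge fj.
have jR : j%:R != 0 :> R by rewrite pnatr_eq0 -lt0n.
exists [ffun u => divergence (fun e => j%:R^-1 * g e) u].
  apply/sym_edge_polytopeP; exists (fun e => j%:R^-1 * g e); split=> //.
  - by split=> e; [rewrite mulr_ge0 // invr_ge0|move=> /g_adj ->; rewrite mulr0].
  - by rewrite -mulr_sumr gj mulVf.
by apply/ffunP => u; rewrite xf !ffunE divergenceZ mulVKf // g_div.
Qed.

Lemma dilate_points_edge_norm j :
  dilate_points (sym_edge_polytope R G) j =
  real_point R G @` sublevel (edge_lattice G) (edge_norm G) j.+1.
Proof.
apply/seteqP; split=> [x /dilate_pointsP[x_int]|_ [z [z_lat zj] <-]].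
  case=> f [[f0 f_adj] fj xE].
  have f_int u : divergence f u \is a Num.int by have := x_int u; rewrite xE ffunE.
  have [g [g_bounds g_div g_size]] := nat_flow_rounding f0 f_int.
  have g_edge : edge_flow g.
    move=> e /f_adj fe; have := g_bounds e; rewrite fe.
    by move=> /(rounding_bounds_int (rpred0 _))/eqP; rewrite pnatr_eq0 => /eqP.
  exists (flow_sum g); last by apply/ffunP => u; rewrite xE !ffunE g_div.
  split; first exact: edge_lattice_flow.
  rewrite /= ltnS (leq_trans (edge_norm_flow_le g_edge)) //.
  by rewrite -(ler_nat R) (le_trans g_size).
have [g [g_edge g_sum g_size]] := edge_norm_flow z_lat; apply/dilate_pointsP; split.
  by move=> u; rewrite ffunE intr_int.
exists (fun e => (g e)%:R); split.
- by split=> e; [rewrite ler0n|move=> /g_edge ->].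
- by rewrite -natr_sum ler_nat -/(flow_size g) g_size.
- by apply/ffunP => u; rewrite -g_sum !ffunE flow_sum_divergence.
Qed.

Lemma ehrhart_edge_norm j :
  ehrhart (sym_edge_polytope R G) j =
  #|` fset_set (sublevel (edge_lattice G) (edge_norm G) j.+1)|.
Proof.
rewrite /ehrhart dilate_points_edge_norm fset_set_image.
  by rewrite card_imfset //; apply: real_point_inj.
exact: graded_finite_edge_lattice.
Qed.

Lemma is_sep_hstarP (h : {poly R}) :
  is_sep_hstar G h <->
  forall N, h = (1 - 'X) ^+ #|G|.-1 * genfun R (edge_lattice G) (edge_norm G) N
              %[modX N].
Proof.
have series N : (1 - 'X) ^+ #|G|.-1.+1
      * \poly_(j < N) (ehrhart (sym_edge_polytope R G) j)%:R
    = (1 - 'X) ^+ #|G|.-1 * genfun R (edge_lattice G) (edge_norm G) N %[modX N].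
  rewrite exprSr -mulrA; apply: eqmodXMl.
  under eq_poly do rewrite ehrhart_edge_norm.
  exact/genfun_cumulative/graded_finite_edge_lattice.
rewrite /is_sep_hstar is_hstarP.
by split=> h_series N; rewrite h_series series.
Qed.

End LatticePoints.

(** * Gluing along an edge *)

Definition pushforward (U V : finType) (h : U -> V) (x : {ffun U -> int}) :
  {ffun V -> int} := [ffun a => vertex_sum (fun u => h u == a) x].

Section Pushforward.
Variables (U V : finType) (h : U -> V).

Fact pushforward_is_zmod_morphism : zmod_morphism (pushforward h).
Proof. by move=> x y; apply/ffunP => a; rewrite !ffunE raddfB. Qed.
HB.instance Definition _ :=
  GRing.isZmodMorphism.Build {ffun U -> int} {ffun V -> int} (pushforward h)
    pushforward_is_zmod_morphism.

Lemma pushforward_arc_vec e : pushforward h (arc_vec e) = arc_vec (h e.1, h e.2).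
Proof.
by apply/ffunP => a; rewrite [RHS]ffunE ffunE vertex_sum_arc_vec !(eq_sym a).
Qed.

Lemma pushforwardE x u : injective h -> pushforward h x (h u) = x u.
Proof.
by move=> h_inj; rewrite ffunE /vertex_sum (big_pred1 u) // => w; apply: inj_eq.
Qed.

Lemma pushforward_eq0 x a : (forall u, h u != a) -> pushforward h x a = 0.
Proof.
by move=> a_out; rewrite ffunE /vertex_sum big_pred0 // => u; apply/negbTE.
Qed.

Lemma pushforward_inj : injective h -> injective (pushforward h).
Proof.
by move=> h_inj x y xy; apply/ffunP => u; rewrite -!(pushforwardE _ _ h_inj) xy.
Qed.

End Pushforward.

Lemma edge_vecs_pushforward (G G' : sgraph) (h : G -> G') :
  {homo h : u v / adj u v} ->
  {in edge_vecs G, forall x, pushforward h x \in edge_vecs G'}.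
Proof.
move=> h_adj _ /edge_vecsP[e e_adj ->].
by rewrite pushforward_arc_vec edge_vecs_arc //= h_adj.
Qed.

Lemma edge_lattice_sum0 (G : sgraph) x : edge_lattice G x -> vertex_sum predT x = 0.
Proof.
case=> s /allP s_edge <-; rewrite raddf_sum big_seq big1 // => y.
by move=> /s_edge/edge_vecsP[e _ ->] /=; rewrite vertex_sum_arc_vec subrr.
Qed.

Lemma bipartite_odd_vertex_sum (G : sgraph) : sgraph_bipartite G ->
  exists P : pred G, {in edge_vecs G, forall x, odd `|vertex_sum P x|}.
Proof.
case=> c c_proper; exists c => _ /edge_vecsP[e /c_proper + ->].
by rewrite vertex_sum_arc_vec; case: (c e.1); case: (c e.2).
Qed.

Section Gluing.
Variables (G1 G2 G : sgraph) (v1 w1 : G1) (v2 w2 : G2) (pi : G1 + G2 -> G).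
Hypothesis glue : edge_gluing v1 w1 v2 w2 pi.
Hypothesis adj2 : adj v2 w2.

Let inl_G (u : G1) : G := pi (inl u).
Let inr_G (u : G2) : G := pi (inr u).

Lemma gluing_eqP x y : pi x = pi y <-> edge_ident v1 w1 v2 w2 x y.
Proof. by case: glue. Qed.

Lemma gluing_inl_inj : injective inl_G.
Proof. by move=> u u' /gluing_eqP/eqP. Qed.

Lemma gluing_inr_inj : injective inr_G.
Proof. by move=> u u' /gluing_eqP/eqP. Qed.

Lemma gluing_tail : inl_G v1 = inr_G v2.
Proof. by apply/gluing_eqP; rewrite /= !eqxx. Qed.

Lemma gluing_head : inl_G w1 = inr_G w2.
Proof. by apply/gluing_eqP; rewrite /= !eqxx orbT. Qed.

Lemma gluing_arc_vec :
  pushforward inl_G (arc_vec (v1, w1)) = pushforward inr_G (arc_vec (v2, w2)).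
Proof. by rewrite !pushforward_arc_vec /= gluing_tail gluing_head. Qed.

Lemma gluing_adj_inl : {homo inl_G : u v / adj u v}.
Proof. by case: glue => _ _ adjE u v uv; apply/adjE; exists (inl u), (inl v). Qed.

Lemma gluing_adj_inr : {homo inr_G : u v / adj u v}.
Proof. by case: glue => _ _ adjE u v uv; apply/adjE; exists (inr u), (inr v). Qed.

Lemma gluing_edge_vecs : {in edge_vecs G, forall z,
  (exists2 x, x \in edge_vecs G1 & z = pushforward inl_G x) \/
  (exists2 y, y \in edge_vecs G2 & z = pushforward inr_G y)}.
Proof.
have [_ _ adjE] := glue.
move=> _ /edge_vecsP[[a b] /= /adjE[[x|x] [[y|y] [<- <- //= xy]]] ->]; [left|right].
  by exists (arc_vec (x, y)); rewrite ?edge_vecs_arc // pushforward_arc_vec.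
by exists (arc_vec (x, y)); rewrite ?edge_vecs_arc // pushforward_arc_vec.
Qed.

Let v2_neq_w2 : v2 != w2.
Proof. by apply: contraTneq adj2 => ->; rewrite adj_irr. Qed.

(* Away from the glued edge [y] vanishes, hence [y] is a multiple of the edge
   vector because its coordinates sum to zero. *)
Lemma gluing_kernel x y :
  edge_lattice G2 y -> pushforward inl_G x + pushforward inr_G y = 0 ->
  exists k : int, x = - (arc_vec (v1, w1) *~ k) /\ y = arc_vec (v2, w2) *~ k.
Proof.
move=> y_lat xy0.
have y_out u : u != v2 -> u != w2 -> y u = 0.
  move=> uv uw; have /ffunP/(_ (inr_G u)) := xy0.
  rewrite ffunE (pushforwardE _ _ gluing_inr_inj) [RHS]ffunE.
  rewrite pushforward_eq0 ?add0r //.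
  by move=> u1; apply/eqP => /gluing_eqP /=; rewrite (negPf uv) (negPf uw) !andbF.
have y_sum : y v2 + y w2 = 0.
  have := edge_lattice_sum0 y_lat; rewrite /vertex_sum.
  rewrite (bigD1 v2) // (bigD1 w2) 1?eq_sym //= big1 ?addr0 // => u /andP[].
  exact: y_out.
have yE : y = arc_vec (v2, w2) *~ y v2.
  apply/ffunP => u; rewrite ffunMzE ffunE /=.
  have [->|uv] := eqVneq u v2; first by rewrite (negPf v2_neq_w2) subr0 intz.
  have [->|uw] := eqVneq u w2; last by rewrite subrr mul0rz y_out.
  by rewrite sub0r mulNrz intz; apply/eqP; rewrite -addr_eq0 addrC y_sum.
exists (y v2); split=> //; apply: (pushforward_inj gluing_inl_inj).
rewrite raddfN raddfMz /= gluing_arc_vec -raddfMz /= -yE.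
by apply/eqP; rewrite -addr_eq0 xy0.
Qed.

Lemma gluing_card : (#|G| + 2 = #|G1| + #|G2|)%N.
Proof.
have [surj _ _] := glue.
pose A := [set inl_G u | u : G1]%SET; pose B := [set inr_G u | u : G2]%SET.
have AB_all : A :|: B = [set: G]%SET.
  apply/setP => a; rewrite !inE; have [[u|u] <-] := surj a.
    by rewrite (imset_f inl_G).
  by rewrite (imset_f inr_G) ?orbT.
have AB_edge : A :&: B = [set inl_G v1; inl_G w1]%SET.
  apply/setP => a; rewrite !inE; apply/andP/orP => [[/imsetP[u _ ->]]|].
    case/imsetP => u' _ /gluing_eqP /= /orP[]/andP[/eqP -> _]; rewrite eqxx.
      by left.
    by right.
  by case=> /eqP ->; rewrite imset_f // ?gluing_tail ?gluing_head imset_f.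
rewrite -(card_imset _ gluing_inl_inj) -(card_imset _ gluing_inr_inj) -cardsUI.
rewrite AB_all AB_edge cardsT cards2 gluing_tail gluing_head.
by rewrite (inj_eq gluing_inr_inj) v2_neq_w2.
Qed.

End Gluing.

(** * The h*-polynomial of the glued graph *)

Section GluedGeneratingFunction.
Variables (R : idomainType) (G1 G2 G : sgraph) (v1 w1 : G1) (v2 w2 : G2).
Variable pi : G1 + G2 -> G.
Hypothesis bip2 : sgraph_bipartite G2.
Hypotheses (adj1 : adj v1 w1) (adj2 : adj v2 w2).
Hypothesis glue : edge_gluing v1 w1 v2 w2 pi.

Let arc1 : arc_vec (v1, w1) \in edge_vecs G1. Proof. exact: edge_vecs_arc. Qed.
Let arc2 : arc_vec (v2, w2) \in edge_vecs G2. Proof. exact: edge_vecs_arc. Qed.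

Lemma genfun_bipartite N :
  (1 - 'X) * genfun R (edge_lattice G2) (edge_norm G2) N =
  (1 + 'X) * genfun R (reduced (edge_vecs G2) (arc_vec (v2, w2))) (edge_norm G2) N
    %[modX N].
Proof.
have [P odd_P] := bipartite_odd_vertex_sum bip2.
apply: (genfun_reduced _ _ arc2 odd_P).
- exact: edge_vecsN.
- exact: edge_norm_double.
- exact: graded_finite_edge_lattice.
Qed.

Lemma genfun_gluing_reduced N :
  genfun R (edge_lattice G) (edge_norm G) N =
  genfun R (edge_lattice G1) (edge_norm G1) N
    * genfun R (reduced (edge_vecs G2) (arc_vec (v2, w2))) (edge_norm G2) N
    %[modX N].
Proof.
have [P odd_P] := bipartite_odd_vertex_sum bip2.
apply: (genfun_amalgam (i1 := pushforward (pi \o inl))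
          (i2 := pushforward (pi \o inr)) _ _ _ _ _ _ _ arc1 arc2 _ odd_P).
- exact/edge_vecs_pushforward/(gluing_adj_inl glue).
- exact/edge_vecs_pushforward/(gluing_adj_inr glue).
- exact: gluing_edge_vecs glue.
- exact: gluing_arc_vec glue.
- by move=> x y _; apply: (gluing_kernel glue adj2).
- exact: edge_vecsN.
- exact: edge_vecsN.
- exact: edge_norm_double.
- exact: graded_finite_edge_lattice.
- exact: graded_finite_edge_lattice.
Qed.

Lemma genfun_gluing N :
  genfun R (edge_lattice G1) (edge_norm G1) N
      * ((1 - 'X) * genfun R (edge_lattice G2) (edge_norm G2) N)
    = (1 + 'X) * genfun R (edge_lattice G) (edge_norm G) N %[modX N].
Proof.
rewrite [RHS](eqmodXMl _ (genfun_gluing_reduced N)) [in RHS]mulrCA.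
exact/eqmodXMl/genfun_bipartite.
Qed.

End GluedGeneratingFunction.

Lemma sep_hstar_gluing (R : realType) (G1 G2 G : sgraph) (v1 w1 : G1) (v2 w2 : G2)
    (pi : G1 + G2 -> G) (H1 H2 : {poly R}) N :
  sgraph_bipartite G2 -> adj v1 w1 -> adj v2 w2 -> edge_gluing v1 w1 v2 w2 pi ->
  is_sep_hstar G1 H1 -> is_sep_hstar G2 H2 ->
  H1 * H2 = (1 + 'X) * ((1 - 'X) ^+ #|G|.-1 *
              genfun R (edge_lattice G) (edge_norm G) N) %[modX N].
Proof.
move=> bip2 adj1 adj2 glue /(is_sep_hstarP adj1 _)/(_ N) H1E.
move=> /(is_sep_hstarP adj2 _)/(_ N) H2E; rewrite (eqmodXM H1E H2E).
rewrite [in RHS]mulrCA -(eqmodXMl _ (genfun_gluing R bip2 adj1 adj2 glue N)).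
have [dim2 dimG] : #|G2|.-1 = #|G2|.-2.+1 /\ #|G|.-1 = (#|G1|.-1 + #|G2|.-2)%N.
  have G1_gt0 : (0 < #|G1|)%N by apply/card_gt0P; exists v1.
  have G2_gt1 : (1 < #|G2|)%N.
    apply/card_gt1P; exists v2, w2; split=> //.
    by apply: contraTneq adj2 => ->; rewrite adj_irr.
  have := gluing_card glue adj2; lia.
by congr take_poly; rewrite dim2 dimG exprD exprS; ring.
Qed.

Lemma dvdp_1DX_of_rational (R : numFieldType) (p q : {poly R})
    (A : nat -> {poly R}) m :
  (forall N, p = (1 + 'X) * A N %[modX N]) ->
  (forall N, (1 - 'X) ^+ m * A N = q %[modX N]) ->
  (1 + 'X %| p)%R /\ forall N, p %/ (1 + 'X) = A N %[modX N].
Proof.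
move=> pE Aq; have dvd_p : (1 + 'X %| p)%R.
  have coprime_1BX : coprimep (1 + 'X : {poly R}) ((1 - 'X) ^+ m).
    rewrite coprimep_expr // -opprB -scaleN1r coprimepZr ?oppr_eq0 ?oner_eq0 //.
    by rewrite -polyC1 coprimep_XsubC /root !hornerE -(natrD _ 1 1) pnatr_eq0.
  rewrite -(Gauss_dvdpr _ coprime_1BX).
  suff -> : (1 - 'X) ^+ m * p = (1 + 'X) * q by apply: dvdp_mulr.
  apply: eqmodX_eq => N; rewrite -(eqmodXMl _ (Aq N)) mulrCA.
  exact: eqmodXMl (pE N).
split=> // N; apply: (@eqmodX_mulI _ _ (1 + 'X)); last by rewrite mulrC divpK.
by rewrite coefD coef1 coefX addr0.
Qed.

Lemma real_rooted_dvdp (R : realType) (p q : {poly R}) :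
  (p %| q)%R -> real_rooted q -> real_rooted p.
Proof.
move=> /dvdpP[r ->] rq z pz; apply: rq.
by rewrite rmorphM rootM pz orbT.
Qed.

Lemma real_rootedM (R : realType) (p q : {poly R}) :
  real_rooted p -> real_rooted q -> real_rooted (p * q).
Proof. by move=> rp rq z; rewrite rmorphM rootM => /orP[/rp|/rq]. Qed.

Theorem theorem4p17 (R : realType) (G1 G2 G : sgraph)
    (v1 w1 : G1) (v2 w2 : G2) (pi : G1 + G2 -> G) (H1 H2 : {poly R}) :
  sgraph_connected G1 ->
  sgraph_connected G2 -> sgraph_bipartite G2 ->
  is_sep_hstar G1 H1 -> is_sep_hstar G2 H2 ->
  adj v1 w1 -> adj v2 w2 -> edge_gluing v1 w1 v2 w2 pi ->
  [/\ (1 + 'X %| H1 * H2)%R,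
      is_sep_hstar G ((H1 * H2) %/ (1 + 'X))
    & real_rooted H1 -> real_rooted H2 ->
      real_rooted ((H1 * H2) %/ (1 + 'X))].
Proof.
move=> _ _ bip2 hstar1 hstar2 adj1 adj2 glue.
have series N := sep_hstar_gluing N bip2 adj1 adj2 glue hstar1 hstar2.
have [p rational] := genfun_edge_lattice_rational G R.
have hstar_rational N : (1 - 'X) ^+ #|{: G * G}| * ((1 - 'X) ^+ #|G|.-1 *
    genfun R (edge_lattice G) (edge_norm G) N) = (1 - 'X) ^+ #|G|.-1 * p %[modX N].
  by rewrite mulrCA; apply/eqmodXMl/rational.
have [dvd_H hstarG] := dvdp_1DX_of_rational series hstar_rational.
split=> //; first by apply/(is_sep_hstarP (gluing_adj_inl glue adj1) _).
move=> real1 real2; apply: real_rooted_dvdp (real_rootedM real1 real2).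
exact: divp_dvd.
Qed.
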